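(* Let $n\geq 4$ and $3\leq k\leq n-1$ be integers. Then the subdiagonal sections of $Q_n$ of order $k$ do not have locally extremal volumes among the central sections of $Q_n$. That is, if $\mathbf{u}\in S^{n-1}$ is a $k$-diagonal direction, then the function $\sigma:S^{n-1}\to\mathbb{R}$, $\sigma(\mathbf{w})=\mathrm{Vol}_{n-1}(Q_n\cap\mathbf{w}^\perp)$, has neither a local maximum nor a local minimum at $\mathbf{u}$.
   Context: $Q_n=[-\frac12,\frac12]^n\subset\mathbb{R}^n$ is the centred unit cube, $S^{n-1}$ is the Euclidean unit sphere in $\mathbb{R}^n$, and $\mathbf{w}^\perp$ is the hyperplane through the origin orthogonal to $\mathbf{w}\in S^{n-1}$. A central section of $Q_n$ is a set $Q_n\cap\mathbf{w}^\perp$ with $\mathbf{w}\in S^{n-1}$, and $\mathrm{Vol}_{n-1}$ is $(n-1)$-dimensional volume. A unit vector is a $k$-diagonal direction if it is parallel to a main diagonal of a $k$-dimensional face of $Q_n$; equivalently, up to permuting coordinates and flipping their signs it equals $\mathbf{d}_{n,k}=\frac{1}{\sqrt{k}}(1,\ldots,1,0,\ldots,0)$ with $k$ ones and $n-k$ zeros. For $1\leq k\leq n-1$, the central section orthogonal to a $k$-diagonal direction is called a subdiagonal section of order $k$. *)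

(* Defs.v *)
From HB Require Import structures.
From mathcomp Require Import all_boot all_order all_algebra all_fingroup.
From mathcomp Require Import ring lra.
From mathcomp Require Import all_classical all_reals all_analysis.

Set Implicit Arguments.
Unset Strict Implicit.
Unset Printing Implicit Defensive.

Import Order.TTheory GRing.Theory Num.Theory.
Import numFieldNormedType.Exports.
Local Open Scope classical_set_scope.
Local Open Scope ring_scope.

Section cons_pair.
Context d (T : measurableType d) (n : nat).

Definition cons_pair (p : T * n.-tuple T) : n.+1.-tuple T :=
  [the n.+1.-tuple T of p.1 :: p.2].

Let measurable_cons_pair : measurable_fun [set: T * n.-tuple T] cons_pair.
Proof. exact: measurable_cons. Qed.

HB.instance Definition _ :=
  isMeasurableFun.Build _ _ _ _ cons_pair measurable_cons_pair.

End cons_pair.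

Section tuple_measure.
Context d (T : measurableType d) (R : realType).
Variable mu : {sigma_finite_measure set T -> \bar R}.

Section cons_measure.
Variables (n : nat) (m : {sigma_finite_measure set (n.-tuple T) -> \bar R}).

Definition cons_measure : set (n.+1.-tuple T) -> \bar R :=
  pushforward (mu \x m)%E (@cons_pair _ T n).

Let cons_measure0 : cons_measure set0 = 0%E.
Proof. exact: measure0. Qed.

Let cons_measure_ge0 A : (0 <= cons_measure A)%E.
Proof. exact: measure_ge0. Qed.

Let cons_measure_sigma_additive : semi_sigma_additive cons_measure.
Proof. exact: measure_semi_sigma_additive. Qed.

HB.instance Definition _ := isMeasure.Build _ _ _ cons_measure
  cons_measure0 cons_measure_ge0 cons_measure_sigma_additive.

Let cons_measure_sigma_finite : sigma_finite setT cons_measure.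
Proof.
pose uncons (t : n.+1.-tuple T) := (thead t, [tuple of behead t]).
have muncons : measurable_fun setT uncons.
  apply: measurable_fun_pair; [exact: measurable_tnth|exact: measurable_behead].
have consK p : uncons (@cons_pair _ T n p) = p.
  by case: p => x t; rewrite /uncons theadE; congr pair; exact: val_inj.
have /sigma_finiteP[F [FT ndF Foo]] := sigma_finiteT mu.
have /sigma_finiteP[G [GT ndG Goo]] := sigma_finiteT m.
exists (fun i => uncons @^-1` (F i `*` G i)).
  rewrite -preimage_bigcup -[LHS](preimage_setT uncons); congr preimage; apply/esym.
  apply/seteqP; split=> // -[x t] _.
  have [i _ Fix] : (\bigcup_i F i) x by rewrite -FT.
  have [j _ Gjt] : (\bigcup_i G i) t by rewrite -GT.
  exists (maxn i j) => //; split => /=.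
  - by move: x Fix; exact/subsetPset/ndF/leq_maxl.
  - by move: t Gjt; exact/subsetPset/ndG/leq_maxr.
move=> i; have [mF Fi] := Foo i; have [mG Gi] := Goo i.
have mFG : measurable (F i `*` G i) by exact: measurableX.
split; first by rewrite -[X in measurable X]setTI; exact: muncons.
rewrite /cons_measure /pushforward (_ : _ @^-1` _ = F i `*` G i); last first.
  by apply/seteqP; split=> p; rewrite /preimage /mkset consK.
by rewrite product_measure1E// lte_mul_pinfty// ge0_fin_numE.
Qed.

HB.instance Definition _ := Measure_isSigmaFinite.Build _ _ _ cons_measure
  cons_measure_sigma_finite.

End cons_measure.

(* The n-fold product of mu. *)
Fixpoint tuple_measure n : {sigma_finite_measure set (n.-tuple T) -> \bar R} :=
  if n is n'.+1 then cons_measure (tuple_measure n')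
  else \d_([tuple] : 0.-tuple T).

End tuple_measure.

Section sections.
Context {R : realType}.
Implicit Types n k : nat.

Definition dotr n (x y : 'rV[R]_n) : R := \sum_i x 0 i * y 0 i.

Definition sphere n : set 'rV[R]_n := [set w | dotr w w = 1].

Definition hyperplane n (w : 'rV[R]_n) : set 'rV[R]_n := [set x | dotr x w = 0].

Definition cube n : set 'rV[R]_n :=
  [set x | forall i, - 2^-1 <= x 0 i <= 2^-1].

(* The rows of B form an orthonormal basis of the hyperplane w^⊥ (w != 0). *)
Definition orthonormal_frame n (w : 'rV[R]_n) (B : 'M[R]_(n.-1, n)) :=
  (forall i j, dotr (row i B) (row j B) = (i == j)%:R) /\
  (forall i, hyperplane w (row i B)).

Lemma orthonormal_frame_ex n (w : 'rV[R]_n) : sphere w ->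
  exists B, orthonormal_frame w B.
Proof.
case: n w => [|m] w sw; first by move: sw => /esym/eqP; rewrite /dotr big_ord0 oner_eq0.
have dotE (x y : 'rV[R]_m.+1) : x *m y^T = (dotr x y)%:M.
  by rewrite [LHS]mx11_scalar mxE; congr _%:M; apply: eq_bigr => i _; rewrite mxE.
pose e (i : 'I_m.+1) := delta_mx 0 i : 'rV[R]_m.+1.
have eE (x : 'rV[R]_m.+1) i : dotr (e i) x = x 0 i.
  rewrite /dotr (bigD1 i)//= mxE !eqxx mul1r big1 ?addr0// => j ji.
  by rewrite mxE (negbTE ji) andbF mul0r.
have dotC (x y : 'rV[R]_m.+1) : dotr x y = dotr y x.
  by apply: eq_bigr => i _; rewrite mulrC.
(* the Householder reflection exchanging w and the first basis vector *)
pose v := w - e 0; pose c := 2 / dotr v v; pose H := 1%:M - c *: (v^T *m v).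
have dv : dotr v v = - 2 * v 0 0.
  have -> : dotr v v =
      dotr w w - dotr (e 0) w - dotr (e 0) w + dotr (e 0) (e 0).
    rewrite /dotr -!sumrB -big_split/=; apply: eq_bigr => i _.
    have -> : v 0 i = w 0 i - e 0 0 i by rewrite /v mxE [X in _ + X]mxE.
    by move: (w 0 i) (e 0 0 i) => a b; ring.
  have -> : v 0 0 = w 0 0 - 1 by rewrite /v mxE [X in _ + X]mxE mxE !eqxx.
  by rewrite sw !eE mxE !eqxx/=; ring.
have v0 : dotr v v = 0 -> v = 0.
  have vv_ge0 i : true -> 0 <= v 0 i * v 0 i by rewrite -expr2 sqr_ge0.
  move=> /(psumr_eq0P vv_ge0) vi0; apply/rowP => i.
  by have /eqP := vi0 i isT; rewrite mulf_eq0 orbb [RHS]mxE => /eqP.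
have HT : H^T = H.
  by rewrite /H linearB/= trmx1 linearZ/= trmx_mul trmxK.
have HH : H *m H = 1%:M.
  have PP : (v^T *m v) *m (v^T *m v) = dotr v v *: (v^T *m v).
    by rewrite mulmxA -(mulmxA v^T v) dotE mul_mx_scalar -scalemxAl.
  rewrite /H mulmxBl mul1mx (mulmxBr (c *: _)) mulmx1 -scalemxAl -scalemxAr PP !scalerA.
  rewrite (_ : c * c * dotr v v = c + c); last first.
    have [s0|s0] := eqVneq (dotr v v) 0; first by rewrite /c s0 invr0 !mulr0 addr0.
    by rewrite /c; field.
  by rewrite scalerDl opprB addrK subrK.
have e0H : e 0 *m H = w.
  rewrite /H (mulmxBr (e 0)) mulmx1 -scalemxAr mulmxA dotE eE mul_scalar_mx scalerA.
  have [s0|s0] := eqVneq (dotr v v) 0.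
    by rewrite /c s0 invr0 mulr0 mul0r scale0r subr0; apply/esym/eqP; rewrite -subr_eq0 -/v v0.
  rewrite (_ : c * v 0 0 = -1) ?scaleN1r ?opprK 1?addrC ?subrK//.
  by rewrite /c; move: s0; rewrite dv mulf_eq0 oppr_eq0 pnatr_eq0/= => v00; field.
have dotH (x y : 'rV[R]_m.+1) : dotr (x *m H) (y *m H) = dotr x y.
  have : (dotr (x *m H) (y *m H))%:M = (dotr x y)%:M :> 'M[R]_1.
    by rewrite -!dotE trmx_mul HT mulmxA -(mulmxA x) HH mulmx1.
  by move=> /matrixP/(_ 0 0); rewrite !mxE !mulr1n.
exists (\matrix_(i < m) row (lift 0 i) H); split=> [i j|i].
- rewrite !rowK !rowE dotH eE mxE eqxx/= (inj_eq lift_inj).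
  by rewrite eq_sym.
- by rewrite /hyperplane/= rowK rowE -e0H dotH eE mxE eqxx.
Qed.

(* The (n-1)-dimensional volume of A `<=` w^⊥ is the Lebesgue measure of A read
   in Cartesian coordinates of w^⊥. As Lebesgue measure is invariant under
   orthogonal maps, the choice of the coordinates is irrelevant. *)
Definition frame n (w : 'rV[R]_n) : 'M[R]_(n.-1, n) :=
  xget 0 [set B | orthonormal_frame w B].

Lemma frameP n (w : 'rV[R]_n) : sphere w -> orthonormal_frame w (frame w).
Proof. by move=> /orthonormal_frame_ex; exact: xgetPex. Qed.

(* The definition is meaningful for w in the unit sphere and A `<=` w^⊥. *)
Definition hyperplane_volume n (w : 'rV[R]_n) (A : set 'rV[R]_n) : \bar R :=
  tuple_measure (@lebesgue_measure R) n.-1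
    [set t | A ((\row_i tnth t i) *m frame w)].

Definition section_volume n (w : 'rV[R]_n) : R :=
  fine (hyperplane_volume w (@cube n `&` hyperplane w)).

Definition cube_vertex n : set 'rV[R]_n :=
  [set p | forall i, p 0 i = - 2^-1 \/ p 0 i = 2^-1].

(* For a vertex p of the cube, the #|J|-dimensional face through p whose free
   coordinates are those in J. *)
Definition cube_face n (J : {set 'I_n}) (p : 'rV[R]_n) : set 'rV[R]_n :=
  @cube n `&` [set x | forall i, i \notin J -> x 0 i = p 0 i].

(* The segment [x, y] joins opposite vertices of that face. *)
Definition main_diagonal n (J : {set 'I_n}) (p x y : 'rV[R]_n) :=
  [/\ (@cube_vertex n `&` cube_face J p) x, (@cube_vertex n `&` cube_face J p) y
    & forall i, i \in J -> y 0 i = - x 0 i].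

Definition diagonal_direction n k (u : 'rV[R]_n) :=
  sphere u /\ exists (J : {set 'I_n}) (p x y : 'rV[R]_n) (c : R),
    [/\ #|J| = k, cube_vertex p, main_diagonal J p x y & u = c *: (y - x)].

Definition diagonal_vector n k : 'rV[R]_n :=
  \row_i (if (i < k)%N then (Num.sqrt k%:R)^-1 else 0).

Lemma perm_initial n (J : {set 'I_n}) :
  exists s : 'S_n, forall i, (s i < #|J|)%N = (i \in J).
Proof.
pose f i := index i (enum J ++ enum (~: J)).
have fin i : i \in enum J ++ enum (~: J).
  by rewrite mem_cat !mem_enum !inE orbN.
have fn i : (f i < n)%N.
  have : (f i < size (enum J ++ enum (~: J)))%N by rewrite index_mem.
  by rewrite size_cat -!cardE cardsC card_ord.
have finj : injective (fun i => Ordinal (fn i)).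
  by move=> i j /(congr1 val)/= /(index_inj i); apply; exact: fin.
exists (perm finj) => i; rewrite permE/= /f index_cat mem_enum -cardE.
by case: ifPn => iJ; rewrite ?ltnNge ?leq_addr// cardE -ltnNge index_mem mem_enum.
Qed.

Lemma diagonal_directionP n k (u : 'rV[R]_n) : (0 < k <= n)%N ->
  diagonal_direction k u <->
  exists (s : 'S_n) (e : 'I_n -> bool),
    u = \row_i ((-1) ^+ e i * diagonal_vector n k 0 (s i)).
Proof.
move=> /andP[k0 kn].
have k0R : 0 < k%:R :> R by rewrite ltr0n.
have sk0 : 0 < Num.sqrt k%:R :> R by rewrite sqrtr_gt0.
have skk : Num.sqrt k%:R ^+ 2 = k%:R :> R by rewrite sqr_sqrtr// ltW.
split.
- move=> [su [J [p [x [y [c [Jk pV [[xV xF] [yV yF] xy] ucE]]]]]]].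
  have [s sE] := perm_initial J.
  have uJN i : i \notin J -> u 0 i = 0.
    by move=> iJ; rewrite ucE !mxE xF.2// yF.2// subrr mulr0.
  have uJ i : i \in J -> u 0 i ^+ 2 = c ^+ 2.
    move=> iJ; rewrite ucE !mxE xy// exprMn.
    by case: (xV i) => ->; field.
  have kc : k%:R * c ^+ 2 = 1.
    rewrite -[RHS]su /dotr (bigID (mem J))/= [X in _ = _ + X]big1 ?addr0; last first.
      by move=> i /uJN ->; rewrite mul0r.
    under eq_bigr => i iJ do rewrite -expr2 uJ//.
    by rewrite sumr_const Jk mulr_natl.
  exists s, (fun i => u 0 i < 0); apply/rowP => i; rewrite !mxE -Jk sE.
  case: ifPn => [iJ|/uJN ->]; last by rewrite mulr0.
  have : `|u 0 i| = (Num.sqrt k%:R)^-1.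
    apply/eqP; rewrite -(@eqrXn2 _ 2)// ?invr_ge0 ?ltW// real_normK ?num_real//.
    by rewrite uJ// exprVn skk -(inj_eq (mulfI (lt0r_neq0 k0R))) kc divff ?lt0r_neq0.
  by rewrite Jk => <-; rewrite mulr_sign_norm.
- move=> [s [e uE]]; pose J : {set 'I_n} := finset (fun i => (s i < k)%N).
  have JE i : (i \in J) = (s i < k)%N by rewrite inE.
  have Jk : #|J| = k.
    rewrite -sum1_card (eq_bigl _ _ JE) (reindex_inj (@perm_inj _ (s^-1)%g))/=.
    under eq_bigl => i do rewrite permKV.
    by rewrite -(big_ord_widen n (fun=> 1%N) kn) sum1_card card_ord.
  pose p : 'rV[R]_n := \row_i ((-1) ^+ e i * 2^-1).
  pose q : 'rV[R]_n := \row_i (if i \in J then - p 0 i else p 0 i).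
  have pV : cube_vertex p.
    by move=> i; rewrite mxE; case: (e i); [left|right]; rewrite ?mulN1r ?mul1r.
  have qV : cube_vertex q.
    move=> i; rewrite mxE; case: ifP => _ //.
    by case: (pV i) => ->; [right|left]; rewrite ?opprK.
  have VQ x : cube_vertex x -> @cube n x.
    by move=> xV i; case: (xV i) => ->; lra.
  split.
    rewrite /sphere/= /dotr (bigID (mem J))/= [X in _ + X]big1 ?addr0; last first.
      by move=> i; rewrite JE uE !mxE => /negbTE ->; rewrite !mulr0.
    rewrite (eq_bigr (fun=> k%:R^-1)) => [|i]; last first.
      rewrite JE uE !mxE => ->; rewrite mulrACA -expr2 sqrr_sign mul1r.
      by rewrite -expr2 exprVn skk.
    by rewrite sumr_const Jk -(mulr_natl (k%:R^-1 : R)) divff ?lt0r_neq0.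
  exists J, p, p, q, (- (Num.sqrt k%:R)^-1); split => //.
    split; [by split => //; split; [exact: VQ|]| |].
    - by split => //; split; [exact: VQ|move=> i /negbTE iJ; rewrite mxE iJ].
    - by move=> i iJ; rewrite mxE iJ.
  apply/rowP => i; rewrite uE !mxE JE; case: ifP => _; last by rewrite subrr !mulr0.
  case: (e i) => /=; field; rewrite ?lt0r_neq0//.
Qed.

Definition local_max_on (T : topologicalType) (A : set T) (f : T -> R) (x : T) :=
  \forall y \near within A (nbhs x), f y <= f x.

Definition local_min_on (T : topologicalType) (A : set T) (f : T -> R) (x : T) :=
  \forall y \near within A (nbhs x), f x <= f y.

End sections.

Arguments sphere {R} n.
Arguments cube {R} n.
Arguments section_volume {R} n w.

(* Main.v *)
Require Import Defs.
From mathcomp Require Import all_boot all_order all_algebra.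
From mathcomp Require Import all_classical all_reals all_analysis.
Import numFieldNormedType.Exports.
From HB Require Import structures.
From mathcomp Require Import all_fingroup ring lra zify measurable_realfun.
Import Order.TTheory GRing.Theory Num.Theory.

Set Implicit Arguments.
Unset Strict Implicit.
Unset Printing Implicit Defensive.
Local Open Scope classical_set_scope.
Local Open Scope ring_scope.

(* Projecting a section along a coordinate axis shows that its volume at w is
   |w| times the density at 0 of sum_i w_i U_i, with U_i independent and uniform
   on [-1/2, 1/2]. Let f_k be the density of U_1 + ... + U_k. Near the diagonal
   direction of order k, making a zero coordinate nonzero increases the volume
   to second order iff 12 f_k(0) + k f_k''(0) > 0, and moving two equal
   coordinates apart decreases it iff k f_{k-2}(0) > (k+1) f_k(0). By Archimedes,
   U_i is the marginal of a uniform point of a sphere in R^3, so f_k is the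
   marginal of a radial density whose profile is -f_k'(r)/r up to a constant. For
   k >= 4 this profile is nonincreasing, by induction from k to k + 2, and for
   large k both inequalities express its monotonicity, at orders k - 1 and k - 2.
   In the degenerate cases k = 4 (first inequality) and k = 3 (second one), where
   equality holds, the next order terms decide. *)

(** * Central differences of powers and sums of uniform variables *)

Section spline.
Context {R : realType}.
Implicit Types (x a b : R) (f : R -> R).

Lemma mean_value f df a b : (forall x, is_derive x 1 f (df x)) -> a < b ->
  exists2 c, a < c < b & f b - f a = df c * (b - a).
Proof.
move=> fdf ab; have [|c + ->] := @MVT R f df a b ab (fun x _ => fdf x).
  by apply: derivable_within_continuous => x _; apply: ex_derive.
by rewrite in_itv/= => cab; exists c.
Qed.

Lemma is_derive_quadratic f x l :
  (forall h, `|f (x + h) - f x - l * h| <= h ^+ 2) -> is_derive x 1 f l.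
Proof.
move=> fl; have fxl : h^-1 *: (f (h + x) - f x) @[h --> 0^'] --> l.
  apply/cvgrPdist_le => /= e e0; near=> h.
  have h0 : h != 0 by near: h; exact: nbhs_dnbhs_neq.
  have he : `|h| < e.
    by near: h; apply: dnbhs0_lt.
  rewrite distrC -[X in X - l]/(h^-1 * _).
  have -> : h^-1 * (f (h + x) - f x) - l = h^-1 * (f (x + h) - f x - l * h).
    by rewrite [h + x]addrC; field.
  rewrite normrM normfV ler_pdivrMl ?normr_gt0// (le_trans (fl h))//.
  by rewrite -real_normK ?num_real// expr2 ler_wpM2l// ltW.
have E : (fun h => h^-1 *: (f (h *: 1 + x) - f x)) = fun h => h^-1 *: (f (h + x) - f x).
  by apply/funext => h; rewrite /GRing.scale/= mulr1.
apply: DeriveDef; first by rewrite /derivable/= E; apply/cvg_ex; exists l.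
by rewrite /derive/= E; apply: cvg_lim.
Unshelve. all: by end_near. Qed.

Lemma is_derive_normr_mul x : is_derive x 1 (fun y => `|y| * y) (2 * `|x|).
Proof.
apply: is_derive_quadratic => h.
have [y ->] : exists y, h = y - x by exists (x + h); ring.
rewrite addrCA subrr addr0; have := sqr_ge0 x; have := sqr_ge0 y; have := sqr_ge0 (y - x).
case: (ger0P x) => x0; case: (ger0P y) => y0; rewrite ler_norml => ? ? ?;
  try (have : x * y <= 0 by nra); move=> *; apply/andP; split; nra.
Qed.

(** The (j+2)-fold primitive of the Dirac mass at 0, beginning with [|x| / 2]. The constants of
    integration make it even or odd, which a truncated power is not. *)
Definition hpow (j : nat) x : R := `|x| * x ^+ j / (2 * (j.+1)`!%:R).

Lemma hpowN j x : hpow j (- x) = (-1) ^+ j * hpow j x.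
Proof. rewrite /hpow normrN (exprNn x); move: (x ^+ j) ((-1) ^+ j) => u v.
by ring. Qed.

Lemma fact_neq0 j : j`!%:R != 0 :> R.
Proof. by rewrite pnatr_eq0 -lt0n fact_gt0. Qed.

Lemma mul_hpow j x : x * hpow j x = j.+2%:R * hpow j.+1 x.
Proof.
rewrite /hpow exprS (factS j.+1) natrM; have := fact_neq0 j.+1.
have : j.+2%:R != 0 :> R by rewrite pnatr_eq0.
move: (j.+2%:R) (j.+1`!%:R) => u v u0 v0; field.
by rewrite u0 v0.
Qed.

Lemma is_derive_hpow j x : is_derive x 1 (hpow j.+1) (hpow j x).
Proof.
have -> : hpow j.+1 = ((2 * (j.+2)`!%:R)^-1 : R) *:
    ((fun y => `|y| * y) * (fun y => y ^+ j) : R -> R).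
  apply/funext => y; rewrite /hpow/= exprS.
  rewrite [RHS]/(_^-1 * ((`|y| * y) * y ^+ j)) [LHS]mulrC.
  by rewrite (mulrA `|y|).
have := is_derive_normr_mul x => dn.
have dx : is_derive x (1:R) (fun y => y ^+ j) (j%:R * x ^+ j.-1).
  have := @is_deriveX R R id j x 1 1 _; rewrite /GRing.scale/= !mulr1 mulr_natl => H.
  have -> : (fun y : R => y ^+ j) = id ^+ j.
    by apply/funext => y; elim: (j) => // i ih; rewrite !exprS ih.
  exact: H.
apply: is_derive_eq; rewrite /GRing.scale/= /hpow (factS j.+1) natrM.
have := fact_neq0 j.+1; have : j.+2%:R != 0 :> R by rewrite pnatr_eq0.
have -> : `|x| * x * (j%:R * x ^+ j.-1) = `|x| * (j%:R * x ^+ j).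
  by case: j {dx} => [|j]; rewrite ?mul0r ?mulr0// exprS/=; ring.
rewrite -[j.+2]addn2 natrD; move: (j%:R) (_ `!%:R) => u v u0 v0; field.
by rewrite u0 v0.
Qed.

(** For a > 0 and smooth f, this is the convolution of the derivative of f with the indicator of
    [-a/2, a/2]. *)
Definition cdiff a f : R -> R := fun x => f (x + a / 2) - f (x - a / 2).

(* spl m j is the (m - j - 2)-th derivative of the density of a sum of m
   independent uniform variables on [-1/2, 1/2], where negative orders stand for
   iterated primitives. *)
Fixpoint spl (m j : nat) : R -> R :=
  if m is m'.+1 then cdiff 1 (spl m' j) else hpow j.

Arguments spl : simpl never.

Lemma spl0 j : spl 0 j = hpow j. Proof. by []. Qed.

Lemma splS m j x : spl m.+1 j x = spl m j (x + 2^-1) - spl m j (x - 2^-1).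
Proof. by rewrite /spl -/spl /cdiff div1r. Qed.

Lemma splSS m j x :
  spl m.+2 j x = spl m j (x + 1) - 2 * spl m j x + spl m j (x - 1).
Proof.
rewrite !splS (_ : x + 2^-1 + 2^-1 = x + 1) ?addrK; last by field.
rewrite subrK (_ : x - 2^-1 - 2^-1 = x - 1); last by field.
by ring.
Qed.

Lemma splN m j x : spl m j (- x) = (-1) ^+ (m + j) * spl m j x.
Proof.
elim: m x => [|m IH] x; first exact: hpowN.
rewrite !splS (_ : - x + 2^-1 = - (x - 2^-1)) -?opprD; last by rewrite opprB addrC.
by rewrite !IH addSn exprS mulN1r mulNr mulrBr opprB.
Qed.

Lemma spl_even m j x : ~~ odd (m + j) -> spl m j (- x) = spl m j x.
Proof. by rewrite splN -signr_odd => /negbTE ->; rewrite mul1r. Qed.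

Lemma spl_odd m j x : odd (m + j) -> spl m j (- x) = - spl m j x.
Proof. by rewrite splN -signr_odd => ->; rewrite expr1 mulN1r. Qed.

Lemma spl_odd0 m j : odd (m + j) -> spl m j 0 = 0.
Proof. by move=> /(spl_odd 0); rewrite oppr0; lra. Qed.

Lemma is_derive_shiftr f df a x :
  is_derive (x + a) 1 f df -> is_derive x 1 (fun y => f (y + a)) df.
Proof.
move=> fd; have := @is_derive1_comp R f (fun y => y + a) x df 1 fd _.
rewrite mulr1; apply; have -> : (fun y => y + a) = id + cst a :> (R -> R) by [].
by apply: is_derive_eq; rewrite addr0.
Qed.

Lemma is_derive_cdiff f df a x : (forall y : R, is_derive y (1 : R) f (df y)) ->
  is_derive x (1 : R) (cdiff a f) (cdiff a df x).
Proof.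
move=> fd; apply: (@is_deriveB _ _ _ (fun y => f (y + a / 2)) (fun y => f (y - a / 2)));
exact: is_derive_shiftr.
Qed.

Lemma is_derive_spl m j x : is_derive x 1 (spl m j.+1) (spl m j x).
Proof.
elim: m x => [|m IH] x; first exact: is_derive_hpow.
exact: is_derive_cdiff.
Qed.

Lemma continuous_spl m j : continuous (spl m j).
Proof.
elim: m => [|m IH] x.
  apply: cvgM; last exact: cvg_cst.
  by apply: cvgM; [exact: norm_continuous|exact: exprn_continuous].
apply: cvgB; apply: (@continuous_comp _ _ _ (fun y => y + _) (spl m j)); (try exact: IH);
by apply: cvgD; [exact: cvg_id|exact: cvg_cst].
Qed.

(* Leibniz rule for central differences, applied to x * x^j. *)
Lemma mul_spl m j x : x * spl m.+1 j x = j.+2%:R * spl m.+1 j.+1 x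
  - m.+1%:R / 2 * (spl m j (x + 2^-1) + spl m j (x - 2^-1)).
Proof.
elim: m x => [|m IH] x.
  by rewrite !splS !spl0 [X in _ = X - _]mulrBr -!mul_hpow; field.
rewrite splS mulrBr.
have -> : x * spl m.+1 j (x + 2^-1) =
  (x + 2^-1) * spl m.+1 j (x + 2^-1) - 2^-1 * spl m.+1 j (x + 2^-1) by ring.
have -> : x * spl m.+1 j (x - 2^-1) =
  (x - 2^-1) * spl m.+1 j (x - 2^-1) + 2^-1 * spl m.+1 j (x - 2^-1) by ring.
rewrite !IH [spl m.+2 _ _]splS.
have := splS m j (x + 2^-1); have := splS m j (x - 2^-1).
rewrite addrK subrK -[m.+2]addn1 natrD.
move: (spl m.+1 j) (spl m.+1 j.+1) (spl m j) => f g h.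
by move=> -> ->; field.
Qed.

Lemma spl_Fdiff m j a b : a < b ->
  exists2 c, a < c < b & spl m j.+1 b - spl m j.+1 a = spl m j c * (b - a).
Proof. by move=> ab; apply: mean_value => // x; exact: is_derive_spl. Qed.

Lemma derive_gt0_lt f df a b :
  (forall x, is_derive x 1 f (df x)) -> a < b ->
  (forall x, a < x < b -> 0 < df x) -> f a < f b.
Proof.
move=> fd ab df0; have [c cab] := mean_value fd ab.
by have := df0 c cab => dfc E; rewrite -subr_gt0 E mulr_gt0 ?subr_gt0.
Qed.

Lemma derive_ge0_le f df a b :
  (forall x, is_derive x 1 f (df x)) -> a <= b ->
  (forall x, a < x < b -> 0 <= df x) -> f a <= f b.
Proof.
move=> fd; rewrite le_eqVlt => /predU1P[->//|ab] df0.
have [c cab] := mean_value fd ab.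
by have := df0 c cab => dfc E; rewrite -subr_ge0 E mulr_ge0 ?subr_ge0// ltW.
Qed.

Lemma derive_lt0_gt f df a b :
  (forall x, is_derive x 1 f (df x)) -> a < b ->
  (forall x, a < x < b -> df x < 0) -> f b < f a.
Proof.
move=> fd ab df0; have [c cab] := mean_value fd ab.
by have := df0 c cab => dfc E; rewrite -subr_lt0 E nmulr_rlt0 ?subr_gt0.
Qed.

Lemma derive_le0_ge f df a b :
  (forall x, is_derive x 1 f (df x)) -> a <= b ->
  (forall x, a < x < b -> df x <= 0) -> f b <= f a.
Proof.
move=> fd; rewrite le_eqVlt => /predU1P[->//|ab] df0.
have [c cab] := mean_value fd ab.
by have := df0 c cab => dfc E; rewrite -subr_le0 E mulr_le0_ge0 ?subr_ge0// ltW.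
Qed.

(** The mean value theorem for [f' x / x], whose derivative is [(x * f'' x - f' x) / x ^+ 2]; the
    positive factor [e] collects the denominators. *)
Lemma slope_diff f' f'' a b : (forall x : R, is_derive x (1:R) f' (f'' x)) ->
  0 < a < b -> exists c e, [/\ a < c < b, 0 < e &
    a * f' b - b * f' a = (c * f'' c - f' c) * e].
Proof.
move=> fd /andP[a0 ab].
have dg (c : R) : 0 < c ->
    is_derive c (1:R) (fun x => f' x / x) ((c * f'' c - f' c) / c ^+ 2).
  move=> c0; have cN0 : c != 0 by rewrite gt_eqF.
  have h := fd c.
  have -> : (fun x => f' x / x) = f' * (fun x => (id x)^-1) by [].
  have hV := @is_deriveV R id c (1:R) 1 cN0 (is_derive_id _ _).
  by apply: is_derive_eq; rewrite /GRing.scale/=; field.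
have [||c] := @MVT R (fun x => f' x / x) (fun c => (c * f'' c - f' c) / c ^+ 2) a b ab.
- by move=> x; rewrite in_itv/= => /andP[ax _]; apply: dg; lra.
- apply: derivable_within_continuous => x; rewrite in_itv/= => /andP[ax _].
  by apply: ex_derive; apply: dg; lra.
rewrite in_itv/= => /andP[ac cb] E; exists c, ((b - a) * (a * b) / c ^+ 2).
have [b0 c0] : 0 < b /\ 0 < c by split; lra.
split; [by rewrite ac cb|by rewrite !(divr_gt0, mulr_gt0) ?exprn_gt0 ?subr_gt0|].
have -> : a * f' b - b * f' a = (f' b / b - f' a / a) * (a * b).
  by field; rewrite !gt_eqF.
by rewrite E; field; rewrite gt_eqF.
Qed.

Lemma slope_le f' f'' a b : (forall x : R, is_derive x (1:R) f' (f'' x)) ->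
  0 < a < b -> (forall x, a < x < b -> 0 <= x * f'' x - f' x) ->
  b * f' a <= a * f' b.
Proof.
move=> fd ab D0; have [c [e [cab e0 E]]] := slope_diff fd ab.
by rewrite -subr_ge0 E mulr_ge0 ?D0// ltW.
Qed.

Lemma slope_lt f' f'' a b : (forall x : R, is_derive x (1:R) f' (f'' x)) ->
  0 < a < b -> (forall x, a < x < b -> 0 < x * f'' x - f' x) ->
  b * f' a < a * f' b.
Proof.
move=> fd ab D0; have [c [e [cab e0 E]]] := slope_diff fd ab.
by rewrite -subr_gt0 E mulr_gt0 ?D0.
Qed.

Lemma is_derive_subX f df k n x l :
  is_derive x (1:R) f df -> df - k * (n.+1%:R * x ^+ n) = l ->
  is_derive x (1:R) (fun u => f u - k * u ^+ n.+1) l.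
Proof.
move=> h <-; have hX := @is_deriveX R R id n.+1 x 1 1 (is_derive_id _ _).
have -> : (fun u => f u - k * u ^+ n.+1) = f - k *: (id ^+ n.+1).
  apply/funext => u; congr (_ - _ * _).
  by elim: (n.+1) => // i ih; rewrite !exprS ih.
by apply: is_derive_eq; rewrite /GRing.scale/= mulr1 mulr_natl.
Qed.

(** * Radial unimodality *)

(* A function f on the line is the marginal of a radial function on R^3 whose
   radial profile is -f' x / x up to a constant, so unimodal f f' f'' says that
   this profile is nonincreasing, and decreasing near the origin. *)
Definition unimodal f' f'' :=
  (forall x, 0 <= x -> 0 <= x * f'' x - f' x) /\
  (forall x, 0 < x < 1 -> 0 < x * f'' x - f' x).

Section unimodal.
Variables (f f' f'' F G : R -> R).
Hypothesis df : forall x : R, is_derive x (1:R) f (f' x).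
Hypothesis df' : forall x : R, is_derive x (1:R) f' (f'' x).
Hypothesis dF : forall x : R, is_derive x (1:R) F (f x).
Hypothesis dG : forall x : R, is_derive x (1:R) G (F x).
Hypothesis fN : forall x, f (- x) = f x.
Hypothesis FN : forall x, F (- x) = - F x.
Hypothesis f_unimodal : unimodal f' f''.

Let F0 : F 0 = 0. Proof. by have := FN 0; rewrite oppr0; lra. Qed.

(* The functional kills f(u) = u^2, F(u) = u^3/3, so that a multiple of u^2 can
   be subtracted from f to make f' vanish at max(x, 1). *)
Lemma unimodal_diff2_lt x : 0 < x <= 1 ->
  0 < x * (f (x + 1) - 2 * f x + f (x - 1)) - (F (x + 1) - 2 * F x + F (x - 1)).
Proof.
move=> /andP[x0 x1]; pose k := f' 1.
pose g u := f u - k / 2 * u ^+ 2; pose H u := F u - k / 6 * u ^+ 3.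
have dg (u : R) : is_derive u (1:R) g (f' u - u * k).
  by apply: (is_derive_subX (df u)); rewrite expr1; field.
have dH (u : R) : is_derive u (1:R) H (g u).
  by apply: (is_derive_subX (dF u)); rewrite /g; field.
have gdecr u v : 0 <= u -> u < v -> v <= 1 -> g v < g u.
  move=> u0 uv v1.
  apply: derive_lt0_gt uv _ => // w.
  move=> /andP[uw wv]; have := @slope_lt f' f'' w 1 df'.
  rewrite mul1r -/k; move=> h; have : f' w < w * k; last by lra.
  by apply: h => [|z /andP[wz z1]]; [|apply: f_unimodal.2]; apply/andP; split; lra.
have gincr u v : 1 <= u -> u <= v -> g u <= g v.
  move=> u0 uv; apply: derive_ge0_le uv _ => // w.
  move=> /andP[uw wv]; have := @slope_le f' f'' 1 w df'.
  rewrite mul1r -/k; move=> h; have : w * k <= f' w; last by lra.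
  by apply: h => [|z /andP[wz z1]]; [apply/andP; split; lra|apply: f_unimodal.1; lra].
(* Since x - 1 <= 0, parity reflects it to 1 - x. Each bracket then compares a value of [g] with its
   mean over an interval where [g] is monotone, with the minimum of [g] at 1; the last comparison is
   strict. *)
have -> : x * (f (x + 1) - 2 * f x + f (x - 1)) - (F (x + 1) - 2 * F x + F (x - 1)) =
    (x * g (1 + x) - (H (1 + x) - H 1)) + (x * g (1 - x) - (H 1 - H (1 - x)))
    + 2 * (H x - x * g x).
  have -> : f (x - 1) = f (1 - x) by rewrite -fN opprB.
  have -> : F (x - 1) = - F (1 - x) by rewrite -FN opprB.
  by rewrite /g /H [x + 1]addrC; field.
have [|c1 c1P ->] := @mean_value H g 1 (1 + x) dH; first by lra.
have [|c2 c2P ->] := @mean_value H g (1 - x) 1 dH; first by lra.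
have [|c3 c3P HE] := @mean_value H g 0 x dH; first by lra.
have {HE} -> : H x = g c3 * x by move: HE; rewrite /H F0; lra.
have h1 : g c1 <= g (1 + x) by apply: gincr; lra.
have h2 : g c2 <= g (1 - x) by apply/ltW/gdecr; lra.
have h3 : g x < g c3 by apply: gdecr; lra.
nra.
Qed.

Lemma unimodal_diff2_ge x : 0 <= x ->
  0 <= x * (f (x + 1) - 2 * f x + f (x - 1)) - (F (x + 1) - 2 * F x + F (x - 1)).
Proof.
rewrite le_eqVlt => /predU1P[<-|x0].
  by rewrite add0r (_ : 0 - 1 = - 1) ?FN ?F0 ?sub0r//; lra.
have [x1|x1] := leP x 1; first by apply/ltW/unimodal_diff2_lt; rewrite x0.
have xN0 : x != 0 by rewrite gt_eqF.
pose k := f' x / x.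
pose g u := f u - k / 2 * u ^+ 2; pose H u := F u - k / 6 * u ^+ 3.
have kE : f' x = x * k by rewrite /k; field.
have dg (u : R) : is_derive u (1:R) g (f' u - u * k).
  by apply: (is_derive_subX (df u)); rewrite expr1; field.
have dH (u : R) : is_derive u (1:R) H (g u).
  by apply: (is_derive_subX (dF u)); rewrite /g; field.
have gdecr u v : 0 <= u -> u <= v -> v <= x -> g v <= g u.
  move=> u0 uv v1.
  apply: derive_le0_ge uv _ => // w.
  move=> /andP[uw wv]; have := @slope_le f' f'' w x df'.
  rewrite kE mulrCA => h; have : x * f' w <= x * (w * k); last by rewrite ler_pM2l//; lra.
  by apply: h => [|z /andP[wz z1]]; [apply/andP; split; lra|apply: f_unimodal.1; lra].
have gincr u v : x <= u -> u <= v -> g u <= g v.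
  move=> u0 uv; apply: derive_ge0_le uv _ => // w.
  move=> /andP[uw wv]; have := @slope_le f' f'' x w df'.
  rewrite kE mulrCA => h; have : x * (w * k) <= x * f' w; last by rewrite ler_pM2l//; lra.
  by apply: h => [|z /andP[wz z1]]; [apply/andP; split; lra|apply: f_unimodal.1; lra].
(* The mean value bounds leave (x - 1) (g(x+1) - g(x)) + x (g(x-1) - g(x)), where both terms are
   nonnegative because x > 1 and [g] is minimal at x. *)
have -> : x * (f (x + 1) - 2 * f x + f (x - 1)) - (F (x + 1) - 2 * F x + F (x - 1)) =
    x * (g (x + 1) - 2 * g x + g (x - 1)) - (H (x + 1) - H x) + (H x - H (x - 1)).
  by rewrite /g /H; field.
have [|c1 c1P ->] := @mean_value H g x (x + 1) dH; first by lra.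
have [|c2 c2P ->] := @mean_value H g (x - 1) x dH; first by lra.
have h1 : g c1 <= g (x + 1) by apply: gincr; lra.
have h2 : g x <= g c2 by apply: gdecr; lra.
have h3 : g x <= g (x + 1) by apply: gincr; lra.
have h4 : g x <= g (x - 1) by apply: gdecr; lra.
nra.
Qed.

(** The functional kills f(u) = u^2, F(u) = u^3/3. Subtracting the multiple of u^2 that makes the
    derivative vanish at 1/2 leaves [g] strictly decreasing on [0, 1/2], so its mean there, 2
    H(1/2), exceeds g(1/2). *)
Lemma unimodal_half : 0 < 2 * f' 2^-1 - 12 * f 2^-1 + 24 * F 2^-1.
Proof.
pose k := 2 * f' 2^-1.
pose g u := f u - k / 2 * u ^+ 2; pose H u := F u - k / 6 * u ^+ 3.
have dg (u : R) : is_derive u (1:R) g (f' u - u * k).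
  by apply: (is_derive_subX (df u)); rewrite expr1; field.
have dH (u : R) : is_derive u (1:R) H (g u).
  by apply: (is_derive_subX (dF u)); rewrite /g; field.
have gdecr u : 0 <= u < 2^-1 -> g 2^-1 < g u.
  move=> /andP[u0 uv].
  apply: derive_lt0_gt uv _ => // w.
  move=> /andP[uw wv]; have := @slope_lt f' f'' w 2^-1 df'.
  move=> h; have : 2^-1 * f' w < w * f' 2^-1; last by rewrite /k; lra.
  by apply: h => [|z /andP[wz z1]]; [|apply: f_unimodal.2]; apply/andP; split; lra.
have [|c cP HE] := @mean_value H g 0 2^-1 dH; first by lra.
have H0 : H 0 = 0 by rewrite /H F0; lra.
have := gdecr c; have -> : g c = 2 * H 2^-1 by move: HE; rewrite H0; lra.
rewrite /g /H /k => h; have : 0 <= c < 2^-1 by lra.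
by move=> /h; lra.
Qed.

(** By parts, the expression is the integral of (1 - u)(2u - 1) f'(u) over [0, 1]. This kernel is
    orthogonal to u, so f'(u) may be replaced by f'(u) - k u, which changes sign at 1/2 exactly as
    the kernel does; [psi] is a primitive of the resulting positive integrand. *)
Lemma unimodal_one : 0 < f 0 + F 1 - 4 * (G 1 - G 0).
Proof.
pose k := 2 * f' 2^-1; pose g u := f u - k / 2 * u ^+ 2.
pose H u := F u - k / 6 * u ^+ 3; pose K u := G u - k / 24 * u ^+ 4.
have dg (u : R) : is_derive u (1:R) g (f' u - u * k).
  by apply: (is_derive_subX (df u)); rewrite expr1; field.
have dH (u : R) : is_derive u (1:R) H (g u).
  by apply: (is_derive_subX (dF u)); rewrite /g; field.
have dK (u : R) : is_derive u (1:R) K (H u).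
  by apply: (is_derive_subX (dG u)); rewrite /H; field.
pose psi u := (1 - u) * (2 * u - 1) * g u + (4 * u - 3) * H u - 4 * K u.
have dpsi (u : R) : is_derive u (1:R) psi ((1 - u) * (2 * u - 1) * (f' u - u * k)).
  have -> : psi = (cst 1 - id) * (2 *: id - cst 1) * g + (4 *: id - cst 3) * H - 4 *: K.
    by apply/funext => v.
  have h1 : is_derive u (1:R) ((cst 1 - id) * (2 *: id - cst 1) : R -> R) (3 - 4 * u).
    apply: is_derive_eq; rewrite /GRing.scale/= /cst.
    transitivity ((1 - u) * (2 * 1 - 0) + (2 * u - 1) * (0 - 1)); first by [].
    by ring.
  have h2 : is_derive u (1:R) (4 *: id - cst 3 : R -> R) 4.
    by apply: is_derive_eq; rewrite /GRing.scale/= /cst; ring.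
  have := is_deriveB (is_deriveD (is_deriveM h1 (dg u)) (is_deriveM h2 (dH u)))
    (is_deriveZ 4 (dK u)).
  move=> h; apply: is_derive_eq; rewrite /GRing.scale/=.
  transitivity ((1 - u) * (2 * u - 1) * (f' u - u * k) + g u * (3 - 4 * u) +
    ((4 * u - 3) * g u + H u * 4) - 4 * H u); first by [].
  by move: (g u) (H u) => a b; ring.
have lt1 : psi 0 < psi 2^-1.
  apply: (derive_gt0_lt dpsi) => [|w /andP[w0 w1]]; first by lra.
  have : f' w - w * k < 0.
    have := @slope_lt f' f'' w 2^-1 df'.
    move=> h; have : 2^-1 * f' w < w * f' 2^-1; last by rewrite /k; lra.
    by apply: h => [|z /andP[wz z1]]; [|apply: f_unimodal.2]; apply/andP; split; lra.
  by move=> h; rewrite nmulr_lgt0 //; nra.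
have lt2 : psi 2^-1 < psi 1.
  apply: (derive_gt0_lt dpsi) => [|w /andP[w0 w1]]; first by lra.
  have : 0 < f' w - w * k.
    have := @slope_lt f' f'' 2^-1 w df'.
    move=> h; have : w * f' 2^-1 < 2^-1 * f' w; last by rewrite /k; lra.
    by apply: h => [|z /andP[wz z1]]; [|apply: f_unimodal.2]; apply/andP; split; lra.
  by move=> h; rewrite mulr_gt0 //; nra.
have := lt_trans lt1 lt2; rewrite /psi /g /H /K F0; lra.
Qed.

End unimodal.

(** * Unimodality of the densities, starting from explicit low orders *)

Ltac abs_simp := do ?[rewrite [`|_|]ger0_norm; last lra | rewrite [`|_|]ler0_norm; last lra].

Lemma hpow0E x : hpow 0 x = `|x| / 2.
Proof. by rewrite /hpow expr0 !mulr1. Qed.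

Lemma hpow1E x : hpow 1 x = `|x| * x / 4.
Proof. by rewrite /hpow expr1 -natrM. Qed.

Lemma hpow2E x : hpow 2 x = `|x| * x ^+ 2 / 12.
Proof. by rewrite /hpow -natrM. Qed.

Lemma hpow3E x : hpow 3 x = `|x| * x ^+ 3 / 48.
Proof. by rewrite /hpow -natrM. Qed.

Definition hpowE := (hpow0E, hpow1E, hpow2E, hpow3E).

Lemma spl_unimodal4 : unimodal (spl 4 1) (spl 4 0).
Proof.
split=> x; rewrite !splSS !spl0 !hpowE.
  move=> x0; have [x2|x2] := leP 2 x; [|have [x1|x1] := leP 1 x]; abs_simp; nra.
by move=> /andP[x0 x1]; abs_simp; nra.
Qed.

Lemma spl_unimodal5 : unimodal (spl 5 2) (spl 5 1).
Proof.
split=> x; rewrite !splSS !splS !spl0 !hpowE.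
  move=> x0; have x3 : 0 <= x * x * x by rewrite !mulr_ge0.
  have [x2|x2] := leP (5 / 2) x; first by abs_simp; nra.
  have [x1|x1] := leP (3 / 2) x.
    (* On each piece the claim is a polynomial inequality of degree 3; the products stated here and
       below make it linear in the monomials. *)
    have h1 : 0 <= x * ((5 / 2 - x) * (5 / 2 - x)) by rewrite !mulr_ge0//; lra.
    have h2 : 0 <= (5 / 2 - x) * ((5 / 2 - x) * (5 / 2 - x)) by rewrite !mulr_ge0//; lra.
    by abs_simp; lra.
  have [xh|xh] := leP (1 / 2) x; last by abs_simp; lra.
  have h1 : 0 <= (x - 1 / 2) * (3 / 2 - x) by rewrite !mulr_ge0//; lra.
  have h2 : 0 <= x * ((x - 1 / 2) * (3 / 2 - x)) by rewrite mulr_ge0.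
  by abs_simp; lra.
move=> /andP[x0 x1]; have x3 : 0 < x * x * x by rewrite !mulr_gt0.
have [xh|xh] := leP (1 / 2) x; last by abs_simp; lra.
have h1 : 0 <= (x - 1 / 2) * (3 / 2 - x) by rewrite !mulr_ge0//; lra.
have h2 : 0 <= x * ((x - 1 / 2) * (3 / 2 - x)) by rewrite mulr_ge0//; lra.
by abs_simp; lra.
Qed.

(** Induction from k to k + 2: the second and first derivatives of f_{k+2} are the second central
    differences of f_k and of its odd primitive. Hence the two base cases 4 and 5. For three
    summands f'(x)/x is constant near 0, so strictness only begins at 4. *)
Lemma spl_unimodal n : unimodal (spl n.+4 n.+1) (spl n.+4 n).
Proof.
suff: unimodal (spl n.+4 n.+1) (spl n.+4 n) /\ unimodal (spl n.+4.+1 n.+2) (spl n.+4.+1 n.+1).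
  by case.
elim: n => [|n [IH1 IH2]]; first by split; [exact: spl_unimodal4|exact: spl_unimodal5].
have fN y : spl n.+4 n.+2 (- y) = spl n.+4 n.+2 y.
  by apply: spl_even; rewrite !addSn !addnS /= !negbK addnn odd_double.
have FN y : spl n.+4 n.+3 (- y) = - spl n.+4 n.+3 y.
  by apply: spl_odd; rewrite !addSn !addnS /= !negbK addnn odd_double.
have df := is_derive_spl n.+4 n.+1.
have df' := is_derive_spl n.+4 n.
have dF := is_derive_spl n.+4 n.+2.
split; first exact: IH2.
split=> x x01; rewrite !(splSS n.+4).
  exact: (unimodal_diff2_ge df df' dF fN FN IH1 x01).
have {}x01 : 0 < x <= 1 by case/andP: x01 => -> /ltW ->.
exact: (unimodal_diff2_lt df df' dF fN FN IH1 x01).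
Qed.

(** * Inequalities between the densities at the origin *)

Lemma spl_half n : n.+2%:R * spl n.+3 n.+1 0 = n.+3%:R * spl n.+2 n 2^-1.
Proof.
(* The recursion at 0 reads (k-1) f_k(0) = k f_{k-1}(1/2), with k = n + 3. *)
have := mul_spl n.+2 n 0; rewrite mul0r add0r sub0r spl_even; last first.
  by rewrite !addSn /= negbK addnn odd_double.
by lra.
Qed.

Lemma spl_ge0 n x : 0 <= spl n.+2 n x.
Proof.
elim: n x => [|n IH] x.
  rewrite splSS !spl0 !hpow0E.
  by have [?|?] := leP x (-1); [|have [?|?] := leP x 0; [|have [?|?] := leP x 1]];
    abs_simp; lra.
rewrite splS; have [|c _ ->] := @spl_Fdiff n.+2 n (x - 2^-1) (x + 2^-1); first by lra.
by rewrite mulr_ge0//; lra.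
Qed.

(** This is (k+1) f_k(0) < k f_{k-2}(0) for k = n + 4. From k = 6 on it is [unimodal_one] for f =
    f_{k-2}: there F(1) = f_{k-1}(1/2) = (k-1) f_k(0) / k and 2 (G(1) - G(0)) = f_k(0). Orders 4 and
    5 are computed. *)
Lemma spl_ratio n : n.+4.+1%:R * spl n.+4 n.+2 0 < n.+4%:R * spl n.+2 n 0.
Proof.
case: n => [|[|n]].
- by rewrite !splSS !spl0 !hpowE; abs_simp; lra.
- by rewrite !splSS !splS !spl0 !hpowE; abs_simp; lra.
have fN y : spl n.+4 n.+2 (- y) = spl n.+4 n.+2 y.
  by apply: spl_even; rewrite !addSn !addnS /= !negbK addnn odd_double.
have FN y : spl n.+4 n.+3 (- y) = - spl n.+4 n.+3 y.
  by apply: spl_odd; rewrite !addSn !addnS /= !negbK addnn odd_double.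
have df := is_derive_spl n.+4 n.+1.
have df' := is_derive_spl n.+4 n.
have dF := is_derive_spl n.+4 n.+2.
have dG := is_derive_spl n.+4 n.+3.
have := unimodal_one df df' dF dG FN (spl_unimodal n).
have := spl_half n.+3.
have -> : spl n.+3.+2 n.+3 2^-1 = spl n.+4 n.+3 1.
  have F0 : spl n.+4 n.+3 0 = 0 by have := FN 0; rewrite oppr0; lra.
  by rewrite splS subrr F0 subr0; congr (spl _ _ _); lra.
have -> : spl n.+3.+3 n.+3.+1 0 = 2 * (spl n.+4 n.+4 1 - spl n.+4 n.+4 0).
  rewrite splSS add0r sub0r spl_even; first by ring.
  by rewrite addnn odd_double.
move: (spl n.+4 n.+2 0) (spl n.+4 n.+3 1) (spl _ _ 1 - _) => f0 F1 c.
have : 0 <= n%:R :> R by [].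
have -> : n.+1.+4%:R = n%:R + 5 :> R by rewrite -natrD !addnS addn0.
have -> : n.+2.+4%:R = n%:R + 6 :> R by rewrite -natrD !addnS addn0.
have -> : n.+3.+4%:R = n%:R + 7 :> R by rewrite -natrD !addnS addn0.
move: (n%:R) => r r0 h1 h2; nra.
Qed.

Lemma spl_gt0 n : 0 < spl n.+2 n 0.
Proof.
have h := spl_ratio n; rewrite -(@pmulr_rgt0 _ n.+4%:R)//.
by apply: le_lt_trans h; rewrite mulr_ge0 ?spl_ge0.
Qed.

(** This is k f_k''(0) + 12 f_k(0) > 0 for k = n + 5. It is [unimodal_half] for f = f_{k-1}: there
    f_k''(0) = 2 f'(1/2), f_k(0) = 2 F(1/2) and k f(1/2) = (k-1) f_k(0). *)
Lemma spl_curvature n :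
  0 < n.+4.+1%:R * spl n.+4.+1 n.+1 0 + 12 * spl n.+4.+1 n.+3 0.
Proof.
have f'N y : spl n.+4 n.+1 (- y) = - spl n.+4 n.+1 y.
  by apply: spl_odd; rewrite !addSn !addnS /= !negbK addnn odd_double.
have FN y : spl n.+4 n.+3 (- y) = - spl n.+4 n.+3 y.
  by apply: spl_odd; rewrite !addSn !addnS /= !negbK addnn odd_double.
have df := is_derive_spl n.+4 n.+1.
have df' := is_derive_spl n.+4 n.
have dF := is_derive_spl n.+4 n.+2.
have := unimodal_half df df' dF FN (spl_unimodal n).
have := spl_half n.+2.
rewrite (splS n.+4 n.+3) (splS n.+4 n.+1) sub0r add0r FN f'N.
move: (spl n.+4 n.+3 _) (spl n.+4 n.+1 _) (spl n.+4 n.+2 _) => F f' f.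
have : 0 <= n%:R :> R by [].
have -> : n.+1.+4%:R = n%:R + 5 :> R by rewrite -natrD !addnS addn0.
have -> : n.+4%:R = n%:R + 4 :> R by rewrite -natrD !addnS addn0.
move: (n%:R) => r r0 h1 h2; nra.
Qed.

(** * Comparison of volumes along the two perturbations *)

Lemma sqrt_mul_lt (k c b E Q : R) : 0 < k -> 0 < c -> 0 < b -> 0 < E ->
  k * b + b * E < 12 * c -> c - b * E / 24 <= Q ->
  Num.sqrt k * c < Num.sqrt (k + E) * Q.
Proof.
move=> k0 c0 b0 E0 kbE cQ.
have bE0 : 0 < b * E by exact: mulr_gt0.
have kb0 : 0 < k * b by exact: mulr_gt0.
have q0 : 0 < c - b * E / 24 by lra.
have sk : 0 <= Num.sqrt k by exact: sqrtr_ge0.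
have skE : 0 < Num.sqrt (k + E) by rewrite sqrtr_gt0; lra.
apply: (@lt_le_trans _ _ (Num.sqrt (k + E) * (c - b * E / 24))); last by rewrite ler_pM2l.
rewrite -ltr_sqr ?nnegrE ?mulr_ge0//; try lra.
rewrite !exprMn !sqr_sqrtr; try lra.
(* The excess over k c^2 is a term led by its part linear in E, positive because k b + b E < 12 c,
   plus a nonnegative multiple of a square. *)
have -> : (k + E) * (c - b * E / 24) ^+ 2 = k * c ^+ 2
    + E * (c * (12 * c - k * b - b * E) / 12) + (k + E) * (b * E / 24) ^+ 2 by field.
have h1 : 0 < E * (c * (12 * c - k * b - b * E) / 12).
  by rewrite !mulr_gt0//; lra.
have : 0 <= (k + E) * (b * E / 24) ^+ 2 by rewrite mulr_ge0 ?sqr_ge0//; lra.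
lra.
Qed.

(** The bound f'' >= -b is integrated three times from 0, where f' and the odd primitive F of f
    vanish by parity. *)
Lemma spl_near_le n (b d : R) : 
  (forall x, 0 < x < d -> - b <= spl n.+4 n x) ->
  forall x, 0 <= x < d -> spl n.+4 n.+2 0 * x - b / 6 * x ^+ 3 <= spl n.+4 n.+3 x.
Proof.
move=> bd.
have f'0 : spl n.+4 n.+1 0 = 0.
  by apply: spl_odd0; rewrite !addSn !addnS /= !negbK addnn odd_double.
have F0 : spl n.+4 n.+3 0 = 0.
  by apply: spl_odd0; rewrite !addSn !addnS /= !negbK addnn odd_double.
have d1 (u : R) : is_derive u (1:R) (fun v => spl n.+4 n.+1 v - (- b) * v ^+ 1)
     (spl n.+4 n u + b).
  by apply: (is_derive_subX (is_derive_spl n.+4 n u)); rewrite expr0; ring.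
have d2 (u : R) : is_derive u (1:R) (fun v => spl n.+4 n.+2 v - (- b / 2) * v ^+ 2)
     (spl n.+4 n.+1 u - (- b) * u ^+ 1).
  by apply: (is_derive_subX (is_derive_spl n.+4 n.+1 u)); field.
have d3' (u : R) := is_derive_subX (k := spl n.+4 n.+2 0) (n := 0)
  (is_derive_spl n.+4 n.+2 u) erefl.
have d3 (u : R) : is_derive u (1:R)
    (fun v => spl n.+4 n.+3 v - spl n.+4 n.+2 0 * v ^+ 1 - (- b / 6) * v ^+ 3)
    (spl n.+4 n.+2 u - spl n.+4 n.+2 0 - (- b / 2) * u ^+ 2).
  by apply: (is_derive_subX (d3' u)); field.
have h1 x : 0 <= x < d -> 0 <= spl n.+4 n.+1 x - (- b) * x ^+ 1.
  move=> /andP[x0 xd].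
  have : forall y, 0 < y < x -> 0 <= spl n.+4 n y + b.
    by move=> y /andP[y0 yx]; rewrite -lerBlDr sub0r bd// y0; lra.
  by move=> /(derive_ge0_le d1 x0); rewrite f'0; lra.
have h2 x : 0 <= x < d -> 0 <= spl n.+4 n.+2 x - spl n.+4 n.+2 0 - (- b / 2) * x ^+ 2.
  move=> /andP[x0 xd].
  have : forall y, 0 < y < x -> 0 <= spl n.+4 n.+1 y - (- b) * y ^+ 1.
    by move=> y /andP[y0 yx]; apply: h1; lra.
  by move=> /(derive_ge0_le d2 x0); lra.
move=> x /andP[x0 xd].
have : forall y, 0 < y < x -> 0 <= spl n.+4 n.+2 y - spl n.+4 n.+2 0 - (- b / 2) * y ^+ 2.
  by move=> y /andP[y0 yx]; apply: h2; lra.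
by move=> /(derive_ge0_le d3 x0); rewrite F0; lra.
Qed.

(** The right side is the volume for k = n + 3 coordinates 1 and one coordinate e: the norm times
    the mean of f_k over [-e/2, e/2]. *)
Lemma diag_increase n : exists2 d : R, 0 < d & forall e, 0 < e < d ->
  Num.sqrt n.+3%:R * spl n.+3 n.+1 0 <
  Num.sqrt (n.+3%:R + e ^+ 2) * (cdiff e (spl n.+3 n.+2) 0 / e).
Proof.
case: n => [|[|n]].
- exists 1 => // e /andP[e0 e1].
  have -> : cdiff e (spl 3 2) 0 / e = 3 / 4 - 2 * e ^+ 2 / 24.
    rewrite /cdiff add0r sub0r !splSS !splS !spl0 !hpowE.
    by abs_simp; field; rewrite gt_eqF.
  have -> : spl 3 1 0 = 3 / 4 by rewrite splSS !splS !spl0 !hpowE; abs_simp; field.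
  apply: (@sqrt_mul_lt _ _ 2) => //; try lra; rewrite ?exprn_gt0//; nra.
(* The degenerate order: 12 f_4(0) + 4 f_4''(0) = 0, so the quadratic terms cancel and the term e^3
   / 64 decides. The square root is bounded below by its Taylor polynomial 2 + e^2/4 - e^4/64. *)
- exists 1 => // e /andP[e0 e1].
  have -> : cdiff e (spl 4 3) 0 / e = 2 / 3 - e ^+ 2 / 12 + e ^+ 3 / 64.
    rewrite /cdiff add0r sub0r !splSS !spl0 !hpowE.
    by abs_simp; field; rewrite gt_eqF.
  have -> : spl 4 2 0 = 2 / 3 by rewrite !splSS !spl0 !hpowE; abs_simp; field.
  have e3 : 0 < e ^+ 3 * (1 - e) by rewrite mulr_gt0 ?exprn_gt0 ?subr_gt0.
  have e5 : 0 < e ^+ 5 by rewrite exprn_gt0.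
  have e7 : e ^+ 7 <= e ^+ 6 by apply: ler_wiXn2l => //; lra.
  have e8 : e ^+ 8 <= e ^+ 6 by apply: ler_wiXn2l => //; lra.
  have e6 : 0 < e ^+ 6 by rewrite exprn_gt0.
  have q0 : 0 < 2 / 3 - e ^+ 2 / 12 + e ^+ 3 / 64.
    have : e ^+ 2 < 1 by rewrite expr_lt1// ltW.
    have : 0 < e ^+ 3 by rewrite exprn_gt0.
    by lra.
  have -> : Num.sqrt 4 = 2 :> R.
    by rewrite (_ : 4 = 2 ^+ 2) ?sqrtr_sqr ?ger0_norm//; ring.
  apply: (@lt_le_trans _ _ ((2 + e ^+ 2 / 4 - e ^+ 4 / 64) *
      (2 / 3 - e ^+ 2 / 12 + e ^+ 3 / 64))); first by lra.
  rewrite ler_pM2r//; apply: (le_trans (ler_norm _)); rewrite -sqrtr_sqr.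
  by apply: ler_wsqrtr; lra.
have c0 := spl_gt0 n.+3; have := spl_curvature n.
have k0 : 0 < n.+4.+1%:R :> R by [].
move: c0 k0; set c := spl _ _ 0; set k := n.+4.+1%:R; set q := spl _ _ 0 => c0 k0 qP.
have qk : - q < 12 * c / k by rewrite ltr_pdivlMr//; lra.
have ck : 0 < 12 * c / k by rewrite divr_gt0// mulr_gt0.
(* By [spl_curvature] there is room for some b > 0 strictly between -f_k''(0) and 12 f_k(0) / k; by
   continuity f_k'' > -b near 0. *)
have [b [bq b0 bk]] : exists b : R, [/\ - q < b, 0 < b & k * b < 12 * c].
  have [b [h1 h2 h3]] : exists b, [/\ - q < b, 0 < b & b < 12 * c / k].
    move: (12 * c / k) (- q) qk ck => X p pX X0.
    by have [p0|p0] := leP p 0; [exists (X / 2)|exists ((X + p) / 2)]; split; lra.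
  by exists b; split => //; move: h3; rewrite ltr_pdivlMr// mulrC.
have qc : {for 0, continuous (spl n.+4.+1 n.+1)} by exact: continuous_spl.
have : \forall x \near (0:R), - b < spl n.+4.+1 n.+1 x.
  apply: (cvgr_gt _ qc); rewrite -/q; lra.
move=> /nbhs_ballP[d0 /= d00 dP].
(* The condition k b + b e^2 < 12 c amounts to e^2 < m, which follows from e < m and e < 1. *)
pose m := (12 * c - k * b) / b.
have m0 : 0 < m by rewrite divr_gt0// subr_gt0.
exists (Num.min d0 (Num.min 1 m)); first by rewrite !lt_min d00 m0 ltr01.
move=> e /andP[e0]; rewrite !lt_min => /and3P[ed e1 em].
have F2 := @spl_near_le n.+1 b d0 _ (e / 2) _.
apply: (@sqrt_mul_lt _ _ b) => //.
- by rewrite exprn_gt0.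
- have : e ^+ 2 < m by rewrite (le_lt_trans _ em)// expr2 ger_pMl//; lra.
  by rewrite /m ltr_pdivlMr// mulrC; lra.
rewrite ler_pdivlMr// /cdiff add0r sub0r spl_odd; last first.
  by rewrite !addSn !addnS /= !negbK addnn odd_double.
suff : c * (e / 2) - b / 6 * (e / 2) ^+ 3 <= spl n.+4.+1 n.+4 (e / 2) by lra.
apply: F2; last by lra.
move=> x /andP[x0 xd]; apply/ltW/dP.
by rewrite /ball/= sub0r normrN gtr0_norm.
Qed.

Lemma sqrtDle (k e : R) : 0 < k -> 0 <= e -> Num.sqrt (k + 2 * e) <= Num.sqrt k * (1 + e / k).
Proof.
move=> k0 e0; have ek : 0 <= e / k by rewrite divr_ge0// ltW.
have -> : Num.sqrt k * (1 + e / k) = Num.sqrt (k * (1 + e / k) ^+ 2).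
  by rewrite sqrtrM ?ltW// sqrtr_sqr ger0_norm//; lra.
rewrite ler_wsqrtr//.
have -> : k * (1 + e / k) ^+ 2 = k + 2 * e + e ^+ 2 / k by field; rewrite gt_eqF.
by rewrite lerDl divr_ge0 ?sqr_ge0// ltW.
Qed.

(** The left side is the volume for the coordinates 1 + e, 1 - e and k - 2 ones, with k = n + 3.
    Here [spl n.+1 n.+1] is the second primitive G of f_{k-2}, so the double difference is 2 (G(1) -
    G(e)), while f_k(0) = 2 (G(1) - G(0)). *)
Lemma diag_decrease n : exists2 d : R, 0 < d & forall e, 0 < e < d ->
  Num.sqrt (n.+3%:R + 2 * e ^+ 2) *
   (cdiff (1 + e) (cdiff (1 - e) (spl n.+1 n.+1)) 0 / (1 - e ^+ 2)) <
  Num.sqrt n.+3%:R * spl n.+3 n.+1 0.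
Proof.
(* A non-strict lower bound on the growth of G suffices, since the expansion of the volume gains a
   term of order e^4. *)
suff [d d0 dP] : exists2 d : R, 0 < d & forall e, 0 < e < d ->
    e ^+ 2 * (n.+4%:R * spl n.+3 n.+1 0 / n.+3%:R) <= 2 * (spl n.+1 n.+1 e - spl n.+1 n.+1 0).
  exists (Num.min d 1); first by rewrite lt_min d0 ltr01.
  move=> e /andP[e0]; rewrite lt_min => /andP[ed e1].
  have := dP e; rewrite e0 ed => /(_ isT).
  have GN y : spl n.+1 n.+1 (- y) = spl n.+1 n.+1 y.
    by apply: spl_even; rewrite addnn odd_double.
  have -> : cdiff (1 + e) (cdiff (1 - e) (spl n.+1 n.+1)) 0
     = 2 * (spl n.+1 n.+1 1 - spl n.+1 n.+1 e).
    rewrite /cdiff !add0r.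
    rewrite (_ : (1 + e) / 2 + (1 - e) / 2 = 1); last by field.
    rewrite (_ : (1 + e) / 2 - (1 - e) / 2 = e); last by field.
    rewrite (_ : - ((1 + e) / 2) + (1 - e) / 2 = - e); last by field.
    rewrite (_ : - ((1 + e) / 2) - (1 - e) / 2 = - 1); last by field.
    by rewrite !GN; ring.
  have cE : spl n.+3 n.+1 0 = 2 * (spl n.+1 n.+1 1 - spl n.+1 n.+1 0).
    by rewrite splSS add0r sub0r GN; ring.
  have c0 := spl_gt0 n.+1; move: c0 cE.
  set c := spl n.+3 n.+1 0; move: (spl _ _ 1) (spl _ _ e) (spl _ _ 0) => g1 ge g0 c0 cE.
  have k0 : 0 < n.+3%:R :> R by [].
  have -> : n.+4%:R = n.+3%:R + 1 :> R by rewrite natr1.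
  move: k0; move: (n.+3%:R) => k k0 h.
  have E1 : e ^+ 2 < 1 by rewrite expr_lt1// ltW.
  have E0 : 0 < e ^+ 2 by rewrite exprn_gt0.
  rewrite mulrA ltr_pdivrMr ?subr_gt0//.
  have sk : 0 < Num.sqrt k by rewrite sqrtr_gt0.
  have ge0 : 0 <= 2 * (g1 - ge) \/ 2 * (g1 - ge) < 0 by case: (lerP 0 (2 * (g1 - ge))); auto.
  case: ge0 => [ge0|ge0]; last first.
    apply: (@le_lt_trans _ _ 0); first by rewrite mulr_ge0_le0 ?sqrtr_ge0// ltW.
    by rewrite !mulr_gt0// subr_gt0.
  move: (e ^+ 2) E0 E1 h => E E0 E1 h.
  apply: (@le_lt_trans _ _ (Num.sqrt k * (1 + E / k) * (2 * (g1 - ge)))).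
    by rewrite ler_wpM2r// sqrtDle// ltW.
  rewrite -(mulrA _ (1 + E / k)) -(mulrA _ c) ltr_pM2l//.
  have h2 : 2 * (g1 - ge) <= c - E * ((k + 1) * c / k) by lra.
  apply: (@le_lt_trans _ _ ((1 + E / k) * (c - E * ((k + 1) * c / k)))).
    by rewrite ler_wpM2l// addr_ge0// divr_ge0// ltW.
  (* The terms linear in E add up to -c E, and the negative E^2 term makes the inequality strict. *)
  have -> : (1 + E / k) * (c - E * ((k + 1) * c / k)) =
     c * (1 - E) - E ^+ 2 * ((k + 1) * c / k ^+ 2) by field; rewrite gt_eqF.
  by rewrite ltrBlDr ltrDl !mulr_gt0 ?invr_gt0 ?exprn_gt0//; lra.
(* For k = 3 equality holds: f_1 = 1 near 0, so G(e) - G(0) = e^2 / 2 for e < 1/2, and 4 f_3(0) / 3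
   = 1. *)
case: n => [|n].
  exists (1 / 2); first by lra.
  move=> e /andP[e0 e1].
  have -> : spl 3 1 0 = 3 / 4 by rewrite splSS !splS !spl0 !hpowE; abs_simp; field.
  by rewrite !splS !spl0 !hpowE; abs_simp; lra.
(* For k >= 4, [spl_ratio] says p < f_{k-2}(0); so f_{k-2} > p near 0, and integrating twice gives
   the bound on G. *)
set p := _ * _ / _.
have pf : p < spl n.+2 n 0.
  by rewrite /p ltr_pdivrMr// [X in _ < X]mulrC spl_ratio.
have fc : {for 0, continuous (spl n.+2 n)}.
  exact: continuous_spl.
have : \forall x \near (0:R), p < spl n.+2 n x by apply: (cvgr_gt _ fc).
move=> /nbhs_ballP[d /= d0 dP]; exists d => // e /andP[e0 ed].
have d1 (u : R) : is_derive u (1:R) (fun v => spl n.+2 n.+1 v - p * v ^+ 1)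
     (spl n.+2 n u - p).
  by apply: (is_derive_subX (is_derive_spl n.+2 n u)); rewrite expr0; ring.
have d2 (u : R) : is_derive u (1:R) (fun v => spl n.+2 n.+2 v - (p / 2) * v ^+ 2)
     (spl n.+2 n.+1 u - p * u ^+ 1).
  by apply: (is_derive_subX (is_derive_spl n.+2 n.+1 u)); field.
have F0 : spl n.+2 n.+1 0 = 0.
  by apply: spl_odd0; rewrite !addSn !addnS /= !negbK addnn odd_double.
have h1 x : 0 <= x < d -> 0 <= spl n.+2 n.+1 x - p * x ^+ 1.
  move=> /andP[x0 xd].
  have : forall y, 0 < y < x -> 0 <= spl n.+2 n y - p.
    move=> y /andP[y0 yx]; rewrite subr_ge0; apply/ltW/dP.
    by rewrite /ball/= sub0r normrN gtr0_norm//; lra.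
  by move=> /(derive_ge0_le d1 x0); rewrite F0; lra.
have : forall y, 0 < y < e -> 0 <= spl n.+2 n.+1 y - p * y ^+ 1.
  by move=> y /andP[y0 yx]; apply: h1; lra.
by move=> /(derive_ge0_le d2 (ltW e0)); lra.
Qed.

End spline.

(** * Linear changes of variables *)

Section linear_change.
Context {R : realType}.
Local Notation mu := (@lebesgue_measure R).
Local Notation T := (measurableTypeR R).
Implicit Types n m : nat.

Definition lebesgue_tuple n := tuple_measure mu n.
Local Notation lam := lebesgue_tuple.

Lemma measurable_cons_pair n :
  measurable_fun [set: T * n.-tuple T] (@cons_pair _ T n).
Proof. exact: measurable_cons. Qed.

Lemma measurable_cons_preimage n (S : set (n.+1.-tuple T)) :
  measurable S -> measurable (@cons_pair _ T n @^-1` S).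
Proof.
by move=> mS; rewrite -[X in measurable X]setTI; exact: measurable_cons_pair.
Qed.

Lemma measurable_cons_section n (S : set (n.+1.-tuple T)) (x : T) :
  measurable S -> measurable [set t | S (cons_pair (x, t))].
Proof.
move=> /measurable_cons_preimage /(measurable_xsection x).
by rewrite xsectionE.
Qed.

Lemma measurable_cons_ysection n (S : set (n.+1.-tuple T)) (t : n.-tuple T) :
  measurable S -> measurable [set x | S (cons_pair (x, t))].
Proof.
move=> /measurable_cons_preimage /(measurable_ysection t).
by rewrite ysectionE.
Qed.

Lemma lebesgue_tupleS n (S : set (n.+1.-tuple T)) :
  lam n.+1 S = (\int[mu]_x lam n [set t | S (cons_pair (x, t))])%E.
Proof.
rewrite /lebesgue_tuple /= /cons_measure /pushforward /product_measure1.
by apply: eq_integral => x _ /=; rewrite xsectionE.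
Qed.

(** Tonelli, through uniqueness of the product measure. Integrating over the head first is what
    shears of the head need. *)
Lemma lebesgue_tupleS' n (S : set (n.+1.-tuple T)) : measurable S ->
  lam n.+1 S = (\int[lam n]_t mu [set x | S (cons_pair (x, t))])%E.
Proof.
move=> /measurable_cons_preimage mS.
rewrite /lebesgue_tuple [LHS]/= /cons_measure /pushforward.
transitivity ((mu \x^ tuple_measure mu n)%E (@cons_pair _ T n @^-1` S)).
  by apply: product_measure_unique => //= A B mA mB; rewrite product_measure2E.
by apply: eq_integral => t _ /=; rewrite ysectionE.
Qed.

Lemma measurable_lebesgue_section n (S : set (n.+1.-tuple T)) : measurable S ->
  measurable_fun [set: T] (fun x : T => lam n [set t | S (cons_pair (x, t))] : \bar R).
Proof.
move=> /measurable_cons_preimage mS.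
have := @lebesgue_integral_fubini.measurable_fun_xsection _ _ _ _ _ (lam n) _ mS.
by congr measurable_fun; apply/funext => x /=; rewrite xsectionE.
Qed.

Lemma measurable_affine (a b : R) : measurable_fun [set: T] (fun x : T => a * x + b : T).
Proof.
apply: measurable_funD; last exact: measurable_cst.
by apply: measurable_funM; [exact: measurable_cst|exact: measurable_id].
Qed.

(** The pushforward of Lebesgue measure, scaled by a, agrees with Lebesgue measure on half-open
    intervals, hence everywhere. *)
Lemma lebesgue_measure_affine_gt0 (a b : R) (S : set T) : 0 < a -> measurable S ->
  mu [set x : R | S (a * x + b)] = (a^-1%:E * mu S)%E.
Proof.
move=> a0 mS; pose f : T -> T := fun x => a * x + b.
pose fm : {mfun T >-> T} := HB.pack f (isMeasurableFun.Build _ _ _ _ f (measurable_affine a b)).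
pose m : {measure set T -> \bar R} := mscale (NngNum (ltW a0)) (pushforward mu fm).
have -> : mu S = m (measurable_affine a b) S.
  apply: lebesgue_measure_unique mS => _ [[c d] _ <-].
  rewrite /m /pushforward/= /mscale/= /pushforward.
  have -> : f @^-1` `]c, d] = `](c - b) / a, (d - b) / a]%classic.
    apply/seteqP; split=> x /=; rewrite !in_itv/= /f ltr_pdivrMr// ler_pdivlMr//;
    by rewrite ltrBlDr lerBrDr mulrC.
  rewrite !lebesgue_measure_itv/= !lte_fin ltr_pM2r ?invr_gt0// ltrD2r.
  case: ifP => _; last by rewrite mule0.
  by rewrite -!EFinD -EFinM; congr EFin; field; rewrite gt_eqF.
by rewrite /m /mscale/= muleA -EFinM mulVf ?gt_eqF// mul1e.
Qed.

Lemma lebesgue_measure_affine (a b : R) (S : set T) : a != 0 -> measurable S ->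
  mu [set x : R | S (a * x + b)] = (`|a|^-1%:E * mu S)%E.
Proof.
move=> a0 mS; have [agt0|alt0|a00] := ltgtP a 0; last by rewrite a00 eqxx in a0.
  have mS' : measurable [set x : T | S (- a * x + b)].
    by rewrite -[X in measurable X]setTI; apply: (measurable_affine (- a) b).
  rewrite ltr0_norm// -(@lebesgue_measure_affine_gt0 (- a) b) ?oppr_gt0//.
  rewrite -(lebesgue_measureN mS'); congr (lebesgue_measure _).
  by apply/seteqP; split=> x; rewrite /= mulrN mulNr opprK.
by rewrite gtr0_norm// lebesgue_measure_affine_gt0.
Qed.

Definition row_of n (t : n.-tuple T) : 'rV[R]_n := \row_i tnth t i.

Definition affine_tuple n (A : 'M[R]_n) (v : 'rV[R]_n) (t : n.-tuple T) : n.-tuple T :=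
  [tuple (row_of t *m A + v) 0 i | i < n].

Lemma row_of_affine n (A : 'M[R]_n) v t :
  row_of (affine_tuple A v t) = row_of t *m A + v.
Proof. by apply/rowP => i; rewrite mxE tnth_mktuple. Qed.

Lemma row_of_inj n : injective (@row_of n).
Proof.
by move=> s t /rowP st; apply/eq_from_tnth => i; have := st i; rewrite !mxE.
Qed.

Lemma measurable_affine_tuple n (A : 'M[R]_n) v :
  measurable_fun setT (affine_tuple A v).
Proof.
apply/measurable_fun_tnthP => i.
rewrite (_ : _ \o _ = fun t : n.-tuple T => (\sum_j tnth t j * A j i + v 0 i : T)); last first.
  apply/funext => t /=; rewrite tnth_mktuple !mxE; congr (_ + _).
  by apply: eq_bigr => j _; rewrite mxE.
apply: measurable_funD; last exact: measurable_cst.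
apply: measurable_sum => j; apply: measurable_funM; last exact: measurable_cst.
exact: measurable_tnth.
Qed.

Lemma measurable_affine_preimage n (A : 'M[R]_n) v (S : set (n.-tuple T)) :
  measurable S -> measurable [set t | S (affine_tuple A v t)].
Proof.
by move=> mS; rewrite -[X in measurable X]setTI; exact: measurable_affine_tuple.
Qed.

(** The translation [v] is part of the property so that induction on n goes through: for a block
    matrix, the slice with head x is translated by [x *: b]. *)
Definition scales_volume n (A : 'M[R]_n) := forall v (S : set (n.-tuple T)),
  measurable S -> lam n [set t | S (affine_tuple A v t)] = (`|\det A|^-1%:E * lam n S)%E.

Lemma scales_volumeM n (A B : 'M[R]_n) :
  scales_volume A -> scales_volume B -> scales_volume (A *m B).
Proof.
move=> hA hB v S mS; have mSB := measurable_affine_preimage B v mS.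
transitivity (lam n [set t | [set s | S (affine_tuple B v s)] (affine_tuple A 0 t)]).
  congr (lam n _); apply/seteqP; split=> t /=;
  by congr S; apply: row_of_inj; rewrite !row_of_affine addr0 mulmxA.
by rewrite hA// hB// muleA -EFinM det_mulmx normrM invfM.
Qed.

Lemma scales_volume0 (A : 'M[R]_0) : scales_volume A.
Proof.
move=> v S mS; rewrite det_mx00 normr1 invr1 mul1e; congr (lam 0 _).
by apply/seteqP; split=> t /=; congr S; apply: row_of_inj; apply/rowP => -[].
Qed.

Lemma cons_pairE n (x : T) (t : n.-tuple T) :
  row_of (cons_pair (x, t)) = row_mx (x%:M : 'M[R]_1) (row_of t) :> 'rV[R]_(1 + n).
Proof.
apply/rowP => i; rewrite !mxE; case: splitP => j ij; rewrite !mxE.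
  by rewrite (ord1 j) (_ : i = ord0) ?mulr1n//; apply: val_inj; rewrite /= ij (ord1 j).
by rewrite (_ : i = lift ord0 j) ?tnthS//; apply: val_inj; rewrite /= ij.
Qed.

Lemma affine_tuple_cons n (a : R) (b : 'rV[R]_n) (c : 'cV[R]_n) (D : 'M[R]_n) v x t :
  affine_tuple (block_mx a%:M b c D : 'M[R]_(1 + n)) v (cons_pair (x, t)) =
  cons_pair (a * x + ((row_of t *m c) 0 0 + lsubmx (v : 'rV[R]_(1 + n)) 0 0) : T,
    affine_tuple D (x *: b + rsubmx (v : 'rV[R]_(1 + n))) t).
Proof.
apply: (@row_of_inj n.+1).
rewrite row_of_affine (cons_pairE x t) cons_pairE row_of_affine.
rewrite -[X in _ + X](@hsubmxK _ 1 1 n) (@mul_row_block R 1 1 n 1 n) (@add_row_mx R 1 1 n).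
apply: (congr2 (@row_mx R 1 1 n)).
  apply/matrixP => i j; rewrite !ord1 !mxE -addrA; congr (_ + _).
  by rewrite big_ord1 !mxE !mulr1n mulrC.
by rewrite mul_scalar_mx addrCA addrA.
Qed.

Lemma measurable_lebesgue_ysection n (S : set (n.+1.-tuple T)) : measurable S ->
  measurable_fun setT (fun t : n.-tuple T => mu [set x | S (cons_pair (x, t))] : \bar R).
Proof.
move=> /measurable_cons_preimage mS.
have := @lebesgue_integral_fubini.measurable_fun_ysection _ _ _ _ _ mu _ mS.
by congr measurable_fun; apply/funext => x /=; rewrite ysectionE.
Qed.

Lemma integral_affine_tuple n (A : 'M[R]_n) v (f : n.-tuple T -> \bar R) :
  scales_volume A -> measurable_fun setT f -> (forall t, (0 <= f t)%E) ->
  (\int[lam n]_t f (affine_tuple A v t) = `|\det A|^-1%:E * \int[lam n]_t f t)%E.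
Proof.
move=> hA mf f0; have dA : 0 <= `|\det A|^-1 by rewrite invr_ge0.
have := @ge0_integral_pushforward _ _ _ _ R _ (measurable_affine_tuple A v)
  (lam n) setT f measurableT mf (fun t _ => f0 t).
rewrite preimage_setT => <-.
transitivity (\int[mscale (NngNum dA) (lam n)]_t f t)%E.
  apply: eq_measure_integral => [|mphi S mS _]; first exact: measurable_affine_tuple.
  by have := hA v S mS.
by rewrite ge0_integral_mscale.
Qed.

Lemma integral_affine (a b : R) (f : T -> \bar R) : a != 0 ->
  measurable_fun setT f -> (forall t, (0 <= f t)%E) ->
  (\int[mu]_x f (a * x + b)%R = `|a|^-1%:E * \int[mu]_x f x)%E.
Proof.
move=> a0 mf f0; have dA : 0 <= `|a|^-1 by rewrite invr_ge0.
have := @ge0_integral_pushforward _ _ _ _ R _ (measurable_affine a b)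
  mu setT f measurableT mf (fun t _ => f0 t).
rewrite preimage_setT => <-.
transitivity (\int[mscale (NngNum dA) mu]_t f t)%E.
  apply: eq_measure_integral => [|mphi S mS _]; first exact: measurable_affine.
  by have := lebesgue_measure_affine b a0 mS.
by rewrite ge0_integral_mscale.
Qed.

(** For a fixed tail the head is only translated, by an amount depending on the tail, so the inner
    integral over the head is unchanged. *)
Lemma scales_volume_shear n (c : 'cV[R]_n) :
  scales_volume (1%:M : 'M[R]_n) ->
  scales_volume (block_mx 1%:M 0 c 1%:M : 'M[R]_(1 + n)).
Proof.
move=> h1 v S mS.
rewrite (@det_lblock R 1 n) !det1 mulr1 normr1 invr1 mul1e.
rewrite !lebesgue_tupleS'//; last exact: measurable_affine_preimage.
pose v' := rsubmx (v : 'rV[R]_(1 + n)).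
transitivity (\int[lam n]_t mu [set x : R | S (cons_pair (x : T, affine_tuple 1%:M v' t))])%E.
  apply: eq_integral => t _.
  have mS' := measurable_cons_ysection (affine_tuple 1%:M v' t) mS.
  have := lebesgue_measure_affine ((row_of t *m c) 0 0 + lsubmx (v : 'rV[R]_(1 + n)) 0 0)
    (oner_neq0 R) mS'.
  rewrite normr1 invr1 mul1e => <-.
  by congr (lebesgue_measure _); apply/seteqP; split=> x /=;
    rewrite affine_tuple_cons scaler0 add0r.
have := @integral_affine_tuple n 1%:M v' _ h1 (measurable_lebesgue_ysection mS).
by rewrite det1 normr1 invr1 mul1e; apply.
Qed.

(** For a fixed head the tail undergoes [D] and a translation, contributing [|\det D|^-1]; the head
    is then rescaled by a. *)
Lemma scales_volume_upper n (a : R) (b : 'rV[R]_n) (D : 'M[R]_n) :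
  a != 0 -> scales_volume D ->
  scales_volume (block_mx a%:M b 0 D : 'M[R]_(1 + n)).
Proof.
move=> a0 hD v S mS.
rewrite (@det_ublock R 1 n) det_scalar1 normrM invfM.
rewrite !lebesgue_tupleS.
pose v0 := lsubmx (v : 'rV[R]_(1 + n)) 0 0.
pose g (x : T) := lam n [set t | S (cons_pair (x, t))].
transitivity (\int[mu]_x (`|\det D|^-1%:E * g (a * x + v0)%R))%E.
  apply: eq_integral => x _.
  rewrite /g -(hD (x *: b + rsubmx (v : 'rV[R]_(1 + n)))); last exact: measurable_cons_section.
  by congr (lam n _); apply/seteqP; split=> t; rewrite /= affine_tuple_cons mulmx0 mxE add0r.
have mg : measurable_fun setT g by exact: measurable_lebesgue_section.
have g0 x : (0 <= g x)%E by exact: measure_ge0.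
have mg' : measurable_fun setT (fun x : T => g (a * x + v0)%R).
  exact: (measurableT_comp mg (measurable_affine a v0)).
rewrite ge0_integralZl_EFin ?invr_ge0//.
by rewrite integral_affine// muleA -EFinM [_^-1 * _^-1]mulrC.
Qed.

Lemma scales_volume1 n : scales_volume (1%:M : 'M[R]_n).
Proof.
elim: n => [|n IH]; first exact: scales_volume0.
have := scales_volume_upper 0 (oner_neq0 R) IH.
by rewrite -(@scalar_mx_block R 1 n 1).
Qed.

(** Gaussian elimination: with a nonzero pivot the matrix is a shear times a block upper triangular
    matrix, whose lower block falls under the induction hypothesis. *)
Lemma scales_volume_unit n (A : 'M[R]_n) : A \in unitmx -> scales_volume A.
Proof.
elim: n A => [|n IH] A Au; first exact: scales_volume0.
suff main (B : 'M[R]_(1 + n)) : B \in unitmx -> B 0 0 != 0 -> scales_volume B.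
  have [A00|] := eqVneq (A 0 0) 0; last exact: main.
  (* If the pivot is 0, some other entry of column 0 is not, and left multiplication by [E 1] adds
     its row to row 0. *)
  have [j Aj0] : exists j, A (lift 0 j) 0 != 0.
    apply/existsP; rewrite -negb_forall; apply/negP => /forallP A0.
    move: Au; rewrite unitmxE (expand_det_col A 0) big1 ?unitr0// => i _.
    case: (unliftP 0 i) => [k ->|->]; last by rewrite A00 mul0r.
    by rewrite (eqP (A0 k)) mul0r.
  pose E s : 'M[R]_(1 + n) := block_mx 1%:M (s *: delta_mx 0 j) 0 1%:M.
  have hE s : scales_volume (E s).
    by apply: scales_volume_upper; [exact: oner_neq0|exact: scales_volume1].
  have EN : E (-1) *m E 1 = 1%:M.
    rewrite (@mulmx_block R 1 n 1 n 1 n) !mul1mx !mulmx1 !mul0mx !mulmx0 !addr0 add0r.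
    by rewrite scaleN1r scale1r subrr -(@scalar_mx_block R 1 n 1).
  have [E1u EN1u] := mulmx1_unit EN.
  rewrite -[A]mul1mx -EN -mulmxA; apply: scales_volumeM => //.
  apply: main; first by rewrite unitmx_mul Au EN1u.
  have l0 : 0 = lshift n 0 :> 'I_(1 + n) by apply: val_inj.
  rewrite mxE [X in X != 0](@big_split_ord _ _ _ 1 n) /= big_ord1.
  rewrite {1 2 3}l0 (@block_mxEul R 1 n 1 n) mxE mulr1n mul1r -l0 A00 add0r.
  rewrite (bigD1 j)//= {1}l0 (@block_mxEur R 1 n 1 n) !mxE !eqxx mulr1 mul1r.
  rewrite big1 ?addr0 => [|k kj]; last first.
    by rewrite {1}l0 (@block_mxEur R 1 n 1 n) !mxE (negbTE kj) andbF mulr0 mul0r.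
  by rewrite (_ : rshift 1 j = lift 0 j)//; apply: val_inj.
move=> Bu B00.
pose b : 'rV[R]_n := ursubmx B; pose c : 'cV[R]_n := dlsubmx B; pose D := drsubmx B.
pose a := B 0 0.
(* The lower right block is the Schur complement of the pivot; it is invertible because the
   determinants multiply. *)
have BE : B = block_mx 1%:M 0 (a^-1 *: c) 1%:M *m block_mx a%:M b 0 (D - a^-1 *: (c *m b)).
  rewrite (@mulmx_block R 1 n 1 n 1 n) !mul1mx !mul0mx !addr0.
  rewrite -[LHS](@submxK R 1 n 1 n); congr block_mx.
  - by rewrite [LHS]mx11_scalar !mxE /a; congr ((B _ _)%:M); apply: val_inj.
  - by rewrite mul_mx_scalar scalerA mulfV// scale1r.
  - by rewrite -scalemxAl addrC subrK.
have Du : D - a^-1 *: (c *m b) \in unitmx.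
  move: Bu; rewrite {1}BE unitmx_mul => /andP[_]; rewrite !unitmxE (@det_ublock R 1 n) det_scalar1.
  by rewrite unitrM => /andP[].
rewrite BE; apply: scales_volumeM; first by apply: scales_volume_shear; exact: scales_volume1.
by apply: scales_volume_upper => //; exact: IH.
Qed.

End linear_change.

(** * Central sections of the cube *)

Section cube_section.
Context {R : realType}.
Local Notation mu := (@lebesgue_measure R).
Local Notation T := (measurableTypeR R).
Local Notation lam := (@lebesgue_tuple R).

(* The coordinates on w^⊥ other than the 0-th change the volume by the factor
   |w_0|, which is a cofactor of the orthogonal matrix with rows w and B. *)
Lemma frame_det m (w : 'rV[R]_m.+1) (B : 'M[R]_(m, m.+1)) :
  sphere m.+1 w -> orthonormal_frame w B -> `|\det (col' 0 B)| = `|w 0 0|.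
Proof.
move=> sw [BB Bw]; pose O : 'M[R]_(1 + m) := col_mx w B.
have dotE p q (X : 'M[R]_(p, m.+1)) (Y : 'M[R]_(q, m.+1)) i j :
    (X *m Y^T) i j = dotr (row i X) (row j Y).
  by rewrite mxE; apply: eq_bigr => l _; rewrite !mxE.
have OO : O *m O^T = 1%:M.
  rewrite /O tr_col_mx mul_col_row (@scalar_mx_block R 1 m 1); congr block_mx.
  - by apply/matrixP => i j; rewrite dotE !ord1 !mxE !row_id sw.
  - apply/matrixP => i j; rewrite dotE !ord1 !mxE row_id -[RHS](Bw j).
    by apply: eq_bigr => l _; rewrite mulrC.
  - by apply/matrixP => i j; rewrite dotE !ord1 [RHS]mxE row_id -[RHS](Bw i).
  - by apply/matrixP => i j; rewrite dotE BB mxE.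
have dO : `|\det O| = 1.
  have : \det O ^+ 2 = 1 by rewrite -(det1 R (1 + m)) -OO det_mulmx det_tr.
  by move/eqP; rewrite sqrf_eq1 => /orP[]/eqP->; rewrite ?normrN normr1.
have [Ou _] := mulmx1_unit OO.
have : O^T = invmx O by rewrite -[LHS](mulKmx Ou) OO mulmx1.
rewrite /invmx Ou => /matrixP/(_ 0 0); rewrite !mxE /cofactor expr0 mul1r.
have -> : row' 0 (col' 0 O) = col' 0 B.
  apply/matrixP => i j; rewrite !mxE.
  case: splitP => k /= ; first by rewrite ord1.
  by rewrite /bump/= add1n => -[] /val_inj ->.
case: splitP => [k _|//]; rewrite (ord1 k) => ->.
by rewrite normrM normfV dO invr1 mul1r.
Qed.

(* For z = 0, the projection along the 0-th axis of the section of the cube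
   orthogonal to (1, v). *)
Definition cube_slab m (v : 'rV[R]_m) (z : R) : set (m.-tuple T) :=
  [set y | (forall i, - 2^-1 <= tnth y i <= 2^-1) /\
           - 2^-1 <= z + dotr (row_of y) v <= 2^-1].

Lemma measurable_cube_slab m (v : 'rV[R]_m) z : measurable (cube_slab v z).
Proof.
have mcc (f : m.-tuple T -> T) : measurable_fun setT f ->
    measurable [set y | - 2^-1 <= f y <= 2^-1].
  move=> mf; have := mf measurableT `[- 2^-1, 2^-1]%classic (measurable_itv _).
  by rewrite setTI; congr measurable; apply/seteqP; split=> y /=; rewrite in_itv.
apply: measurableI; last first.
  apply: mcc; apply: measurable_funD; first exact: measurable_cst.
  apply: measurable_sum => j; apply: measurable_funM; last exact: measurable_cst.
  rewrite [X in measurable_fun _ X](_ : _ = (fun t : m.-tuple T => tnth t j)).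
    exact: measurable_tnth.
  by apply/funext => t; rewrite mxE.
have := @fin_bigcap_measurable _ _ 'I_m [set: 'I_m]
  (fun i => [set y : m.-tuple T | - 2^-1 <= (tnth y i : R) <= 2^-1]) (@finite_finset _ _) _.
have -> : \bigcap_(i in [set: 'I_m]) [set y : m.-tuple T | - 2^-1 <= (tnth y i : R) <= 2^-1] =
    (fun y => forall i, - 2^-1 <= tnth y i <= 2^-1).
  by apply/seteqP; split=> y /= h i; [exact: h|move=> _; exact: h].
by apply=> i _; apply: mcc; exact: measurable_tnth.
Qed.

(** Dropping the 0-th coordinate of t B is a linear map of determinant w_0 = 1/N up to sign. The
    dropped coordinate is recovered from orthogonality to (1, v) as x_0 = -<y, v>, and the sign is
    immaterial as the interval is symmetric. *)
Lemma frame_volume m (w : 'rV[R]_m.+1) (B : 'M[R]_(m, m.+1)) (N : R) (v : 'rV[R]_m) :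
  sphere m.+1 w -> orthonormal_frame w B -> 0 < N ->
  w = N^-1 *: (row_mx (1%:M : 'M[R]_1) v : 'rV[R]_(1 + m)) ->
  lam m [set t | (cube m.+1 `&` hyperplane w) (row_of t *m B)] =
  (N%:E * lam m (cube_slab v 0))%E.
Proof.
move=> sw wB N0 wE; have NV0 : N^-1 != 0 by rewrite gt_eqF// invr_gt0.
have w0 : w 0 0 = N^-1.
  by rewrite wE !mxE; case: splitP => // k _; rewrite (ord1 k) mxE mulr1.
have wS i : w 0 (lift 0 i) = N^-1 * v 0 i.
  rewrite wE !mxE; case: splitP => k /=; first by rewrite (ord1 k).
  by rewrite /bump/= add1n => -[] /val_inj ->.
have dB := frame_det sw wB.
have Bu : col' 0 B \in unitmx.
  by rewrite unitmxE unitfE -normr_gt0 dB w0 gtr0_norm invr_gt0.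
transitivity (lam m [set t | cube_slab v 0 (affine_tuple (col' 0 B) 0 t)]); last first.
  rewrite scales_volume_unit//; last exact: measurable_cube_slab.
  by rewrite dB w0 gtr0_norm ?invr_gt0// invrK.
congr (lam m _); apply/seteqP.
suff H t : (cube m.+1 `&` hyperplane w) (row_of t *m B) <->
    cube_slab v 0 (affine_tuple (col' 0 B) 0 t).
  by split=> t /= /H.
pose x := row_of t *m B; pose y := row_of t *m col' 0 B.
have yE i : y 0 i = x 0 (lift 0 i) by rewrite !mxE; apply: eq_bigr => j _; rewrite !mxE.
have xw : dotr x w = 0.
  rewrite /dotr; under eq_bigr do rewrite mxE mulr_suml.
  rewrite exchange_big big1//= => i _.
  under eq_bigr do rewrite -mulrA.
  rewrite -mulr_sumr -[RHS](mulr0 (row_of t 0 i)); congr (_ * _).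
  by rewrite -[RHS](wB.2 i); apply: eq_bigr => j _; rewrite mxE.
have x0 : x 0 0 = - dotr y v.
  move: xw; rewrite /dotr big_ord_recl w0.
  under eq_bigr do rewrite wS -yE mulrCA.
  rewrite -mulr_sumr mulrC -mulrDr => /eqP; rewrite mulf_eq0 (negbTE NV0)/=.
  by rewrite addr_eq0 => /eqP.
have tE i : tnth (affine_tuple (col' 0 B) 0 t) i = x 0 (lift 0 i).
  by rewrite tnth_mktuple addr0 -/y yE.
rewrite /cube_slab/= row_of_affine addr0 -/y add0r; split.
  move=> [xc _]; split=> [i|]; first by rewrite tE; exact: xc.
  by have := xc 0; rewrite -/x x0 => /andP[? ?]; apply/andP; split; lra.
move=> [yc y0]; split=> // i; rewrite -/x.
case: (unliftP 0 i) => [j ->|->]; first by have := yc j; rewrite tE.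
by rewrite x0; case/andP: y0 => ? ?; apply/andP; split; lra.
Qed.

(** * Slab volumes as iterated central differences *)

Lemma cube_slabS m (a : R) (l : seq R) z :
  lam m.+1 (cube_slab (\row_i (a :: l)`_i) z) =
  (\int[mu]_(x in `[(- 2^-1)%R, (2^-1)%R]) lam m (cube_slab (\row_i l`_i) (z + a * x)%R))%E.
Proof.
rewrite lebesgue_tupleS [RHS]integral_mkcond; apply: eq_integral => x _.
have sE t : cube_slab (\row_i (a :: l)`_i) z (cons_pair (x, t)) <->
    - 2^-1 <= x <= 2^-1 /\ cube_slab (\row_(i < m) l`_i) (z + a * x) t.
  rewrite /cube_slab/= (_ : dotr _ _ = a * x + dotr (row_of t) (\row_i l`_i)); last first.
    rewrite /dotr big_ord_recl !mxE mulrC; congr (_ + _); apply: eq_bigr => i _.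
    by rewrite !mxE tnthS.
  rewrite addrA; split=> [[h1 h2]|[h1 [h2 h3]]].
    split; first exact: (h1 0).
    by split=> // i; have := h1 (lift 0 i); rewrite tnthS.
  by split=> // i; case: (unliftP 0 i) => [j ->|-> //]; rewrite tnthS.
rewrite patchE; case: ifPn => xi.
  congr (lam m _); apply/seteqP; split=> t /=; first by move=> /sE[].
  by move=> ?; apply/sE; split=> //; move: xi => /set_mem/=; rewrite in_itv.
rewrite (_ : [set _ | _] = set0) ?measure0//; apply/seteqP; split=> t //= /sE[xh _].
by move: xi; rewrite notin_setE/= in_itv/= xh.
Qed.

(** Entries beyond the end of a list read as the default 0, so this slab is the whole cube or empty,
    according to z. *)
Lemma cube_slab0 m z :
  lam m (cube_slab (\row_i [::]`_i) z) = (\1_`[- 2^-1, 2^-1] z)%:E.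
Proof.
elim: m z => [|m IH] z.
  rewrite /lebesgue_tuple/= diracE indicE; congr (_ %:E); congr (_ %:R); congr nat_of_bool.
  apply/idP/idP => /set_mem h; apply/mem_set; move: h;
    rewrite /cube_slab/= /dotr big_ord0 addr0 in_itv/=; first by case.
  by move=> ?; split=> // -[].
have -> : \row_(i < m.+1) [::]`_i = \row_i (0 :: [::])`_i :> 'rV[R]__.
  by apply/rowP => i; rewrite !mxE nth_nil; case: (nat_of_ord i) => //= j; rewrite nth_nil.
rewrite cube_slabS; under eq_integral do rewrite mul0r addr0 IH.
rewrite integral_cst//= lebesgue_measure_itv/= lte_fin ifT; last by lra.
by rewrite -EFinD -EFinM; congr EFin; lra.
Qed.

Lemma integral_derive (f F : R -> R) a b : a < b -> continuous f ->
  (forall x : R, is_derive x (1 : R) F (f x)) ->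
  (\int[mu]_(x in `[a, b]) (f x)%:E = (F b - F a)%:E)%E.
Proof.
move=> ab cf dF; rewrite EFinB; apply: continuous_FTC2 => //.
- exact: continuous_subspaceT.
- have cF : continuous F.
    move=> x; apply/differentiable_continuous/derivable1_diffP.
    by apply: ex_derive; exact: dF.
  split=> [x _||].
  + by apply: ex_derive; exact: dF.
  + by apply: cvg_at_right_filter; exact: cF.
  + by apply: cvg_at_left_filter; exact: cF.
- by move=> x _; rewrite derive1E; apply: derive_val; exact: dF.
Qed.

Definition cdiffs (l : seq R) (f : R -> R) := foldr cdiff f l.

Lemma is_derive_cdiffs l (f df : R -> R) (x : R) :
  (forall y : R, is_derive y (1 : R) f (df y)) ->
  is_derive x (1 : R) (cdiffs l f) (cdiffs l df x).
Proof.
move=> fd; elim: l x => [|a l IH] x; first exact: fd.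
exact: is_derive_cdiff.
Qed.

Lemma continuous_cdiffs l (f : R -> R) : continuous f -> continuous (cdiffs l f).
Proof.
move=> cf; elim: l => [//|a l IH] x.
apply: cvgB; apply: (@continuous_comp _ _ _ (fun y => y + _) (cdiffs l f)); (try exact: IH);
by apply: cvgD; [exact: cvg_id|exact: cvg_cst].
Qed.

Lemma is_derive_comp_affine (c z a : R) (G g : R -> R) (x : R) :
  (forall y : R, is_derive y (1 : R) G (g y)) ->
  is_derive x (1 : R) (fun y => c * G (z + a * y)) (c * (a * g (z + a * x))).
Proof.
have h1 : is_derive x (1 : R) (fun y => z + a * y) a.
  apply: is_derive_quadratic => h; rewrite (_ : _ - _ = 0) ?normr0 ?sqr_ge0//; ring.
move=> dG; have h2 := @is_derive1_comp R G (fun y => z + a * y) x _ _ (dG _) h1.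
have -> : c * (a * g (z + a * x)) = c *: (g (z + a * x) * a) by rewrite (mulrC a).
exact: (is_deriveZ c h2).
Qed.

(** The length of the overlap of [-1/2, 1/2] and [u, v], put in the form of a double difference of
    [|x| / 2], that is, of [hpow 0]. *)
Lemma overlap_length (u v : R) : u < v ->
  (if Num.max (- 2^-1) u < Num.min 2^-1 v
   then Num.min 2^-1 v - Num.max (- 2^-1) u else 0) =
  (`|2^-1 - u| - `|2^-1 - v| - `|2^-1 + u| + `|2^-1 + v|) / 2.
Proof.
move=> uv; rewrite maxEle minEle.
case: (leP (- 2^-1) u) => h1; case: (leP 2^-1 v) => h2; case: ltP => h3;
case: (ger0P (2^-1 - u)) => h4; case: (ger0P (2^-1 - v)) => h5;
case: (ger0P (2^-1 + u)) => h6; case: (ger0P (2^-1 + v)) => h7; lra.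
Qed.

(** The innermost integrand jumps, so the fundamental theorem of calculus that serves for the
    further coordinates is replaced by the length of an overlap. *)
Lemma integral_slab1 (b z : R) : 0 < b ->
  (\int[mu]_(x in `[(- 2^-1)%R, (2^-1)%R]) (\1_`[- 2^-1, 2^-1] (z + b * x)%R)%:E =
   (b^-1 * cdiff b (cdiff 1 (hpow 0)) z)%:E)%E.
Proof.
move=> b0; pose lo := Num.max (- 2^-1) ((- 2^-1 - z) / b).
pose hi := Num.min 2^-1 ((2^-1 - z) / b).
transitivity (\int[mu]_(x in `[(- 2^-1)%R, (2^-1)%R]) (\1_`[lo, hi] x)%:E)%E.
  apply: eq_integral => x /set_mem/=; rewrite in_itv/= => xh; rewrite !indicE.
  congr (_ %:E); congr (_ %:R); congr nat_of_bool.
  rewrite /lo /hi; apply/idP/idP => /set_mem h; apply/mem_set; move: h;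
  by rewrite /= !in_itv/= ge_max le_min ler_pdivrMr// ler_pdivlMr//; lra.
rewrite integral_indic//= setIidl; last first.
  move=> x /=; rewrite !in_itv/= /lo /hi ge_max le_min.
  by move=> /andP[/andP[-> _] /andP[-> _]].
rewrite lebesgue_measure_itv/= lte_fin.
have uv : (- 2^-1 - z) / b < (2^-1 - z) / b by rewrite ltr_pM2r ?invr_gt0//; lra.
have := overlap_length uv; rewrite -/lo -/hi => E.
transitivity ((if lo < hi then hi - lo else 0)%:E); first by case: ifP.
rewrite E; congr EFin; rewrite /cdiff !hpow0E.
have bN (x y : R) : b * x = y -> `|y| = b * `|x| by move=> <-; rewrite normrM gtr0_norm.
have bN0 : b != 0 by rewrite gt_eqF.
rewrite (bN (2^-1 - (- 2^-1 - z) / b) (z + b / 2 + 1 / 2)); last by field.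
rewrite (bN (2^-1 - (2^-1 - z) / b) (z + b / 2 - 1 / 2)); last by field.
rewrite (bN (- (2^-1 + (- 2^-1 - z) / b)) (z - b / 2 + 1 / 2)); last by field.
rewrite (bN (- (2^-1 + (2^-1 - z) / b)) (z - b / 2 - 1 / 2)); last by field.
by rewrite !normrN; field.
Qed.

(** By induction on [l]: integrating out a coordinate with coefficient a yields 1/a times the
    central difference, with step a, of a primitive. The [j] further coordinates have coefficient 0
    and contribute the factor 1. *)
Lemma cube_slab_pos (l : seq R) j z : l != [::] -> all (fun a => 0 < a) l ->
  lam (size l + j) (cube_slab (\row_i l`_i) z) =
  ((\prod_(a <- l) a)^-1 * cdiffs l (cdiff 1 (hpow (size l).-1)) z)%:E.
Proof.
elim: l z => [//|a [|b l] IH] z _.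
  rewrite /= andbT big_seq1 => a0.
  rewrite cube_slabS; under eq_integral do rewrite cube_slab0.
  exact: integral_slab1.
move=> /andP[a0] l0'; have {l0'} l0 : all (fun a : R => 0 < a) (b :: l) := l0'.
rewrite cube_slabS.
under eq_integral do rewrite (IH _ isT l0).
set P := \prod_(i <- _ :: l) i; set n := (size (b :: l)).-1.
pose g := cdiffs (b :: l) (cdiff 1 (hpow n)).
pose G := cdiffs (b :: l) (cdiff 1 (hpow n.+1)).
have dG (x : R) : is_derive x (1:R) G (g x).
  by apply: is_derive_cdiffs => y; apply: is_derive_cdiff => u; exact: is_derive_hpow.
rewrite big_cons -/P.
have P0 : 0 < P by rewrite /P big_seq prodr_gt0// => i /(allP l0).
have dH (x : R) : is_derive x (1 : R)
    (fun x => (a * P)^-1 * G (z + a * x)) (P^-1 * g (z + a * x)).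
  have -> : P^-1 * g (z + a * x) = (a * P)^-1 * (a * g (z + a * x)).
    by field; rewrite !gt_eqF.
  exact: is_derive_comp_affine.
have cH : continuous (fun x : R => P^-1 * g (z + a * x)).
  move=> x; apply: cvgM; first exact: cvg_cst.
  apply: (@continuous_comp _ _ _ (fun y => z + a * y) g).
    by apply: cvgD; [exact: cvg_cst|apply: cvgM; [exact: cvg_cst|exact: cvg_id]].
  by apply: continuous_cdiffs => u; exact: (@continuous_spl R 1 n).
rewrite (integral_derive _ cH dH); last by lra.
congr EFin; rewrite -mulrBr; congr (_ * _).
by rewrite [RHS]/(G (z + a / 2) - G (z - a / 2)) mulrN.
Qed.

(** * Perturbations of the diagonal directions *)

Definition signed_perm n (s : 'S_n) (e : 'I_n -> bool) (x : 'rV[R]_n) : 'rV[R]_n :=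
  \row_i ((-1) ^+ e i * x 0 (s i)).

Lemma dotr_signed_perm n s e (x y : 'rV[R]_n) :
  dotr (signed_perm s e x) (signed_perm s e y) = dotr x y.
Proof.
rewrite /dotr [RHS](reindex_inj (@perm_inj _ s)); apply: eq_bigr => i _.
by rewrite !mxE mulrACA -expr2 sqrr_sign mul1r.
Qed.

Lemma cube_signed_perm n s e (x : 'rV[R]_n) :
  cube n (signed_perm s e x) <-> cube n x.
Proof.
have signK i : - 2^-1 <= (-1) ^+ e i * x 0 (s i) <= 2^-1 <-> - 2^-1 <= x 0 (s i) <= 2^-1.
  by case: (e i) => /=; split=> h; lra.
split=> h i; last by rewrite mxE; apply/signK/h.
by have := h (s^-1 i)%g; rewrite mxE => /signK; rewrite permKV.
Qed.

Lemma signed_perm_mul n m s e (B : 'M[R]_(m, n)) (t : 'rV[R]_m) :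
  t *m (\matrix_i signed_perm s e (row i B)) = signed_perm s e (t *m B).
Proof.
apply/rowP => j; rewrite !mxE mulr_sumr; apply: eq_bigr => i _.
by rewrite !mxE mulrCA.
Qed.

Definition row_seq n (l : seq R) : 'rV[R]_n := \row_i l`_i.

Lemma dotr_row_seq n (l : seq R) : (size l <= n)%N ->
  dotr (row_seq n l) (row_seq n l) = \sum_(a <- l) a ^+ 2.
Proof.
elim: l n => [|a l IH] n ln.
  by rewrite big_nil /dotr big1// => i _; rewrite mxE nth_nil mul0r.
case: n ln => [//|n] ln; rewrite big_cons -(IH n ln) /dotr big_ord_recl !mxE -expr2.
by congr (_ + _); apply: eq_bigr => i _; rewrite !mxE.
Qed.

(** The leading entry is 1 before normalisation because the section is projected along its axis; the
    other nonzero entries form [l]. *)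
Lemma section_volume_seq n (l : seq R) s e (N := Num.sqrt (1 + \sum_(a <- l) a ^+ 2))
    (w := signed_perm s e (N^-1 *: row_seq n (1 :: l))) :
  (size l < n)%N -> l != [::] -> all (fun a => 0 < a) l ->
  sphere n w /\
  section_volume n w = N * ((\prod_(a <- l) a)^-1 * cdiffs l (cdiff 1 (hpow (size l).-1)) 0).
Proof.
move=> ln lN l0; pose v := N^-1 *: row_seq n (1 :: l).
have NN : 0 < 1 + \sum_(a <- l) a ^+ 2.
  by rewrite ltr_pwDl// sumr_ge0// => a _; exact: sqr_ge0.
have N0 : 0 < N by rewrite sqrtr_gt0.
have sv : sphere n v.
  rewrite /sphere/= (_ : dotr v v = N ^- 2 * dotr (row_seq n (1 :: l)) (row_seq n (1 :: l))).
    rewrite dotr_row_seq// big_cons expr1n -[X in _ * X](sqr_sqrtr (ltW NN)) -/N.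
    by rewrite mulVf// sqrf_eq0 gt_eqF.
  by rewrite /dotr mulr_sumr; apply: eq_bigr => i _; rewrite !mxE; field; rewrite gt_eqF.
have sw : sphere n w by rewrite /sphere/= dotr_signed_perm.
split=> //.
have [j nE] : exists j, n = (size l + j).+1 by exists (n - (size l).+1)%N; lia.
have [FF Fw] := frameP sw.
(* Undoing the signed permutation turns the chosen frame of [w] into a frame of [v]; the cube and
   the inner product are invariant. *)
pose B : 'M[R]_(n.-1, n) := \matrix_(i, k) ((-1) ^+ e (s^-1 k)%g * frame w i (s^-1 k)%g).
have FB : frame w = \matrix_i signed_perm s e (row i B).
  apply/matrixP => i k; rewrite !mxE permK mulrA -expr2 sqrr_sign mul1r //.
have rF i : row i (frame w) = signed_perm s e (row i B) by rewrite FB rowK.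
have fB : orthonormal_frame v B.
  split=> [i i'|i]; first by rewrite -FF !rF dotr_signed_perm.
  by have := Fw i; rewrite /hyperplane/= rF dotr_signed_perm.
have -> : section_volume n w =
    fine (lam n.-1 [set t | (cube n `&` hyperplane v) (row_of t *m B)]).
  rewrite /section_volume /hyperplane_volume; congr (fine (lam _ _)).
  apply/seteqP; split=> t /=; rewrite -/(row_of t) {1 2}FB signed_perm_mul;
    rewrite /hyperplane/= dotr_signed_perm; case=> h1 h2; split=> //;
    by [apply/cube_signed_perm: h1 | exact/(cube_signed_perm s e)].
clear FB rF FF Fw sw; clearbody B; clear w; rewrite {}/v in fB sv *; subst n.
rewrite (@frame_volume _ _ _ N (row_seq (size l + j) l) sv fB N0).
  by rewrite cube_slab_pos// -EFinM.
congr (_ *: _); apply/rowP => i; rewrite !mxE.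
case: splitP => k /= ik; rewrite ik !mxE; first by rewrite (ord1 k) mulr1n.
by [].
Qed.

Lemma cdiffC (a b : R) f : cdiff a (cdiff b f) = cdiff b (cdiff a f).
Proof.
apply/funext => x; rewrite /cdiff.
rewrite [x + a / 2 + _]addrAC [x + a / 2 - _]addrAC [x - a / 2 + _]addrAC.
by rewrite [x - a / 2 - _]addrAC; ring.
Qed.

Lemma cdiffs_nseq q j : cdiffs (nseq q 1) (cdiff 1 (hpow j)) = spl q.+1 j :> (R -> R).
Proof. by elim: q => //= q ->. Qed.

Lemma cdiffs_cat_nseq q j (a : R) :
  cdiffs (nseq q 1 ++ [:: a]) (cdiff 1 (hpow j)) = cdiff a (spl q.+1 j).
Proof. by elim: q => //= q ->; rewrite cdiffC. Qed.

(** The entries before normalisation contribute e, and the norms contribute at most 2 e, since M - N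
    <= M^2 - N^2 = E once N >= 1. *)
Lemma normalize_dist (K E e y y0 : R) : 1 <= K -> 0 <= E <= 2 * e ->
  `|y - y0| <= e -> `|y0| <= 1 ->
  `|(Num.sqrt (K + E))^-1 * y - (Num.sqrt K)^-1 * y0| <= 3 * e.
Proof.
move=> K1 /andP[E0 Ee] ye y1; set M := Num.sqrt (K + E); set N := Num.sqrt K.
have N1 : 1 <= N by rewrite -[leLHS]sqrtr1 ler_wsqrtr.
have NM : N <= M by rewrite ler_wsqrtr// lerDl.
have [N2 M2] : N ^+ 2 = K /\ M ^+ 2 = K + E by rewrite !sqr_sqrtr//; lra.
have [M0 N0] : M != 0 /\ N != 0 by rewrite !gt_eqF//; lra.
have -> : M^-1 * y - N^-1 * y0 = M^-1 * (y - y0) - (M - N) / (M * N) * y0.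
  by field; rewrite M0 N0.
have e0 : 0 <= e by rewrite (le_trans _ ye).
rewrite (le_trans (ler_normB _ _))// !normrM.
have h1 : `|M^-1| * `|y - y0| <= 1 * e.
  by rewrite ler_pM// normfV invf_le1 ?normr_gt0// ger0_norm; lra.
have h2 : `|M - N| * `|(M * N)^-1| * `|y0| <= (2 * e) * 1 * 1.
  have a1 : `|M - N| <= 2 * e.
    rewrite ger0_norm ?subr_ge0//.
    have : (M - N) * (M + N) <= 2 * e by rewrite -subr_sqr M2 N2; lra.
    by apply: le_trans; rewrite ler_peMr ?subr_ge0//; lra.
  have a2 : `|(M * N)^-1| <= 1.
    by rewrite normfV invf_le1 ?normr_gt0 ?mulf_neq0// ger0_norm; nra.
  by rewrite !ler_pM ?mulr_ge0.
by rewrite (le_trans (lerD h1 h2))//; lra.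
Qed.

Lemma diagonal_vectorE n q : diagonal_vector n q.+3 =
  (Num.sqrt q.+3%:R)^-1 *: row_seq n (1 :: nseq q.+2 1) :> 'rV[R]_n.
Proof.
apply/rowP => i; rewrite !mxE -[1 :: _]/(nseq q.+3 (1 : R)) nth_nseq.
by case: ifP; rewrite ?mulr1 ?mulr0.
Qed.

Lemma sum_sqr_nseq q : \sum_(a <- nseq q (1 : R)) a ^+ 2 = q%:R.
Proof. by rewrite big_nseq expr1n iter_addr_0. Qed.

Lemma prod_nseq1 q : \prod_(a <- nseq q (1 : R)) a = 1.
Proof. by rewrite big_nseq; elim: q => //= q ->; rewrite mulr1. Qed.

Lemma all_nseq1_gt0 q : all (fun a : R => 0 < a) (nseq q 1).
Proof. by rewrite all_nseq ltr01 orbT. Qed.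

Lemma diagonal_volume n q s e : (q.+2 < n)%N ->
  section_volume n (signed_perm s e (diagonal_vector n q.+3)) =
  Num.sqrt q.+3%:R * spl q.+3 q.+1 0.
Proof.
move=> qn; rewrite diagonal_vectorE.
have := @section_volume_seq n (nseq q.+2 1) s e.
rewrite size_nseq sum_sqr_nseq nat1r prod_nseq1 invr1 mul1r cdiffs_nseq => h.
by have [] := h qn isT (all_nseq1_gt0 _).
Qed.

Section perturbation.
Variables (n q : nat) (s : 'S_n) (e : 'I_n -> bool) (l : R -> seq R) (E : R -> R).
Hypothesis size_l : forall x, (size (l x) < n)%N.
Hypothesis l_nil : forall x, l x != [::].
Hypothesis l_gt0 : forall x, 0 < x < 1 -> all (fun a => 0 < a) (l x).
Hypothesis l_sqr : forall x, \sum_(a <- l x) a ^+ 2 = q.+2%:R + E x.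
Hypothesis E_le : forall x, 0 < x < 1 -> 0 <= E x <= 2 * x.
Hypothesis l_near : forall x i, 0 < x < 1 ->
  `|(1 :: l x)`_i - (1 :: nseq q.+2 1)`_i| <= x.

(** The part common to both perturbations: [l x] holds the entries after the leading 1, and [E x] is
    the increase of the squared norm. *)
Lemma perturbed_sections (U : set 'rV[R]_n) :
  nbhs (signed_perm s e (diagonal_vector n q.+3)) U ->
  exists2 d : R, 0 < d & forall x, 0 < x < d -> exists w, [/\ U w, sphere n w &
    section_volume n w = Num.sqrt (q.+3%:R + E x) *
      ((\prod_(a <- l x) a)^-1 * cdiffs (l x) (cdiff 1 (hpow (size (l x)).-1)) 0)].
Proof.
(* By [normalize_dist] every entry moves by at most 3 x, which is below r when x < r / 4. *)
move=> /nbhs_ballP[r /= r0 rU]; exists (Num.min 1 (r / 4)).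
  by rewrite lt_min ltr01 divr_gt0.
move=> x /andP[x0]; rewrite lt_min => /andP[x1 xr].
have x01 : 0 < x < 1 by rewrite x0.
have NE : 1 + \sum_(a <- l x) a ^+ 2 = q.+3%:R + E x by rewrite l_sqr addrA nat1r.
have [] := @section_volume_seq n (l x) s e (size_l x) (l_nil x) (l_gt0 x01).
rewrite NE => sw vw; eexists; split; [|exact: sw|exact: vw].
apply: rU; split=> // i j; rewrite diagonal_vectorE (ord1 i) !mxE.
rewrite /ball/= -mulrBr normrM normrX normrN1 expr1n mul1r distrC.
have y1 (y : R) i' : y = (1 :: nseq q.+2 1)`_i' -> `|y| <= 1.
  move=> ->; rewrite -[1 :: _]/(nseq q.+3 (1 : R)) nth_nseq.
  by case: ifP; rewrite ?normr1 ?normr0.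
have := normalize_dist (K := q.+3%:R) _ (E_le x01) (l_near (s j) x01) (y1 _ _ erefl).
by rewrite ler1n => /(_ isT) /le_lt_trans; apply; lra.
Qed.

End perturbation.

Lemma diagonal_not_local_max n q s e : (q.+3 < n)%N ->
  ~ local_max_on (sphere n) (section_volume n) (signed_perm s e (diagonal_vector n q.+3)).
Proof.
move=> qn; rewrite /local_max_on /prop_near1/= => max_u.
(* One of the zero coordinates, available since k = q + 3 < n, becomes x. *)
pose l (x : R) := nseq q.+2 1 ++ [:: x].
have sl x : size (l x) = q.+3 by rewrite size_cat size_nseq addn1.
have [||||||d1 d10 dP] := @perturbed_sections n q s e l (fun x => x ^+ 2) _ _ _ _ _ _ _ max_u.
- by move=> x; rewrite sl.
- by move=> x; rewrite -size_eq0 sl.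
- by move=> x /andP[x0 _]; rewrite all_cat all_nseq1_gt0/= x0.
- by move=> x; rewrite big_cat sum_sqr_nseq big_seq1.
- by move=> x /andP[x0 x1]; rewrite sqr_ge0/= expr2; nra.
- move=> x i /andP[x0 x1]; rewrite -[1 :: l x]/(nseq q.+3 (1 : R) ++ [:: x]).
  rewrite -[1 :: _]/(nseq q.+3 (1 : R)) nth_cat size_nseq.
  case: ltnP => iq; first by rewrite subrr normr0 ltW.
  rewrite [X in _ - X]nth_default ?size_nseq// subr0.
  by case: (i - _)%N => [|j] /=; rewrite ?nth_nil ?normr0 ?gtr0_norm// ltW.
have [d2 d20 d2P] := @diag_increase R q.
pose x := Num.min d1 d2 / 2.
have m0 : 0 < Num.min d1 d2 by rewrite lt_min d10.
have [xd1 xd2] : 0 < x < d1 /\ 0 < x < d2.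
  have h1 : Num.min d1 d2 <= d1 by rewrite ge_min lexx.
  have h2 : Num.min d1 d2 <= d2 by rewrite ge_min lexx orbT.
  by split; rewrite /x; lra.
have [w [Uw sw vw]] := dP x xd1.
have := Uw sw; rewrite vw diagonal_volume; last exact: ltnW.
rewrite leNgt => /negP; apply.
have -> : \prod_(a <- l x) a = x by rewrite big_cat prod_nseq1 big_seq1; exact: mul1r.
rewrite sl cdiffs_cat_nseq [X in _ < _ * X]mulrC.
exact: d2P.
Qed.

Lemma diagonal_not_local_min n q s e : (q.+3 < n)%N ->
  ~ local_min_on (sphere n) (section_volume n) (signed_perm s e (diagonal_vector n q.+3)).
Proof.
move=> qn; rewrite /local_min_on /prop_near1/= => min_u.
(* Two equal coordinates move apart with their sum kept; the squared norm grows by 2 x^2. *)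
pose l (x : R) := [:: 1 + x, 1 - x & nseq q 1].
have sl x : size (l x) = q.+2 by rewrite /= size_nseq.
have [||||||d1 d10 dP] := @perturbed_sections n q s e l (fun x => 2 * x ^+ 2) _ _ _ _ _ _ _ min_u.
- by move=> x; rewrite sl ltnW.
- by [].
- by move=> x /andP[x0 x1] /=; rewrite all_nseq1_gt0 andbT; lra.
- move=> x; rewrite !big_cons sum_sqr_nseq -[q.+2]addn2 natrD; ring.
- by move=> x /andP[x0 x1]; rewrite mulr_ge0 ?sqr_ge0//= expr2; nra.
- move=> x i /andP[x0 _]; have {}x0 := ltW x0; case: i => [|[|[|i]]] /=.
  + by rewrite subrr normr0.
  + by rewrite (_ : 1 + x - 1 = x) ?ger0_norm//; ring.
  + by rewrite (_ : 1 - x - 1 = - x) ?normrN ?ger0_norm//; ring.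
  + by rewrite subrr normr0.
have [d2 d20 d2P] := @diag_decrease R q.
pose x := Num.min d1 (Num.min 1 d2) / 2.
have m0 : 0 < Num.min d1 (Num.min 1 d2) by rewrite !lt_min d10 ltr01.
have [xd1 xd2 x1] : [/\ 0 < x < d1, 0 < x < d2 & x < 1].
  have h1 : Num.min d1 (Num.min 1 d2) <= d1 by rewrite ge_min lexx.
  have h2 : Num.min d1 (Num.min 1 d2) <= d2 by rewrite !ge_min lexx !orbT.
  have h3 : Num.min d1 (Num.min 1 d2) <= 1 by rewrite !ge_min lexx !orbT.
  by split; rewrite /x; lra.
have [w [Uw sw vw]] := dP x xd1.
have := Uw sw; rewrite vw diagonal_volume; last exact: ltnW.
rewrite leNgt => /negP; apply.
rewrite sl !big_cons prod_nseq1 mulr1 -[cdiffs _ _]/(cdiff _ (cdiff _ (cdiffs _ _))) cdiffs_nseq.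
have -> : (1 + x) * (1 - x) = 1 - x ^+ 2 by ring.
by rewrite [X in _ * X < _]mulrC; exact: d2P.
Qed.

End cube_section.

Theorem theorem1p4 (R : realType) (n k : nat) (u : 'rV[R]_n) :
  (4 <= n)%N -> (3 <= k <= n - 1)%N -> diagonal_direction k u ->
  ~ local_max_on (sphere n) (section_volume n) u /\
  ~ local_min_on (sphere n) (section_volume n) u.
Proof.
move=> n4 /andP[k3 kn].
have kn' : (k < n)%N by lia.
rewrite diagonal_directionP; last by lia.
case: k k3 kn kn' => [|[|[|q]]]// _ _ qn [s [e ->]].
by split; [exact: diagonal_not_local_max|exact: diagonal_not_local_min].
Qed.
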